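(* Let $V$ be an $n$-dimensional real vector space with a volume element, and let $V^*$ be its dual space with the dual volume element. Let $K \subset V$ be a symmetric convex body, and suppose that there are two ellipsoids $E_1, E_2 \subset V$ and a real number $r \ge 2$ such that $E_1 \subseteq K \subseteq E_2$ and $(\operatorname{Vol} E_2)/(\operatorname{Vol} E_1) = r^n$. Then, for any ellipsoid $B \subset V$, $$\frac{(\operatorname{Vol} K)(\operatorname{Vol} K^\circ)}{(\operatorname{Vol} B)(\operatorname{Vol} B^\circ)} \ge (2\log_2 r)^{-n}.$$
   Context: $V$ is a finite-dimensional vector space over $\mathbb{R}$ with a volume element, and $V^*$ is its dual vector space with the dual volume element (so if $V=\mathbb{R}^n$ with Lebesgue measure, $V^*$ is identified with $\mathbb{R}^n$ with Lebesgue measure via the standard dot product). A convex body is a compact convex set with nonempty interior. A convex set is symmetric if it is invariant under $x \mapsto -x$. For a symmetric convex body $K \subset V$, its dual (polar) is $K^\circ = \{y \in V^* \mid y(K) \subset [-1,1]\}$. An ellipsoid in $V$ is a set of the form $\{x \in V \mid \langle x,x\rangle \le 1\}$ for some positive-definite inner product $\langle\cdot,\cdot\rangle$ on $V$ (in particular it is centered at the origin). The product $(\operatorname{Vol} B)(\operatorname{Vol} B^\circ)$ does not depend on the choice of the ellipsoid $B \subset V$; it equals $b_n^2$, where $b_n$ is the volume of the Euclidean unit ball in $\mathbb{R}^n$. *)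

(* Defs.v *)
From HB Require Import structures.
From mathcomp Require Import all_boot all_order all_algebra.
From mathcomp Require Import all_classical all_reals all_analysis.

Set Implicit Arguments.
Unset Strict Implicit.
Unset Printing Implicit Defensive.

Import Order.TTheory GRing.Theory Num.Theory.
Import numFieldNormedType.Exports.

Local Open Scope classical_set_scope.
Local Open Scope ring_scope.

(* The canonical topology of a finite-dimensional real vector space, pulled
   back from the coordinate space 'rV[R]_(\dim {:V}); the choice of basis is
   immaterial. *)
Definition vtop (R : realType) (V : vectType R) : Type :=
  initial_topology (passmx.rVof (vbasis {:V})).

HB.instance Definition _ (R : realType) (V : vectType R) :=
  Topological.on (vtop V).
HB.instance Definition _ (R : realType) (V : vectType R) :=
  isPointed.Build (vtop V) (0 : V).

Definition borel (R : realType) (V : vectType R) :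
    measurableType (@open (vtop V)).-sigma :=
  g_sigma_algebraType (@open (vtop V)).

Definition dualv (R : realType) (V : vectType R) : vectType R := 'Hom(V, R^o).

(* A volume element on V is taken to be the associated measure on V, that is, a
   translation-invariant Borel measure, nonzero and finite on compact sets. *)
Definition volume_element (R : realType) (V : vectType R)
    (mu : {measure set (borel V) -> \bar R}) : Prop :=
  [/\ forall (A : set (borel V)) (v : V), measurable A ->
        mu [set (x : V) + v | x in A] = mu A,
      forall K : set (vtop V), compact K -> (mu K < +oo)%E
    & mu setT != 0%E].

Definition parallelepiped (R : realType) (V : vectType R) (n : nat)
    (e : n.-tuple V) : set V :=
  [set x | exists t : 'I_n -> R,
     (forall i, 0 <= t i <= 1) /\ x = \sum_(i < n) t i *: tnth e i].

(* nu is the volume element on V^* dual to the volume element mu on V: the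
   parallelepipeds spanned by a basis of V and by its dual basis have inverse
   volumes. By the change of variables formula this does not depend on the
   basis, so asking for it for one basis determines nu. *)
Definition dual_volume_element (R : realType) (V : vectType R)
    (mu : {measure set (borel V) -> \bar R})
    (nu : {measure set (borel (dualv V)) -> \bar R}) : Prop :=
  volume_element nu /\
  exists (e : (\dim {:V}).-tuple V) (f : (\dim {:V}).-tuple (dualv V)),
    [/\ basis_of {:V} e,
        forall i j, (tnth f i : 'Hom(V, R^o)) (tnth e j) = (i == j)%:R
      & (mu (parallelepiped e) * nu (parallelepiped f) = 1)%E].

(* Only used on bounded Borel sets, where mu is finite. *)
Definition vol (R : realType) (V : vectType R)
    (mu : {measure set (borel V) -> \bar R}) (A : set V) : R := fine (mu A).

Definition convex_body (R : realType) (V : vectType R) (K : set V) : Prop :=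
  [/\ compact (K : set (vtop V)), convex_set K
    & interior (K : set (vtop V)) !=set0].

Definition symmetric_set (R : realType) (V : vectType R) (K : set V) : Prop :=
  [set - x | x in K] = K.

Definition polar (R : realType) (V : vectType R) (K : set V) :
    set (dualv V) :=
  [set y : 'Hom(V, R^o) | y @` K `<=` `[-1, 1]].

Definition ellipsoid (R : realType) (V : vectType R) (E : set V) : Prop :=
  exists g : {dot V for idfun}, E = [set x | g x x <= 1].

Definition log2 (R : realType) (x : R) : R := ln x / ln 2.

(* Main.v *)
Require Import Defs.
From HB Require Import structures.
From mathcomp Require Import all_boot all_order all_algebra.
From mathcomp Require Import all_classical all_reals all_analysis.
From mathcomp Require Import measurable_realfun ring lra.

Set Implicit Arguments.
Unset Strict Implicit.
Unset Printing Implicit Defensive.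

Import Order.TTheory GRing.Theory Num.Theory.
Import numFieldNormedType.Exports.

Local Open Scope classical_set_scope.
Local Open Scope ring_scope.

(** The threshold 4 is forced from both sides: among r >= 2, the bound r <= 2 log2 r holds only up
    to 4, with equality at 2 and 4, while sqrt r >= 2, which is needed to repeat the step, holds
    only from 4 on. The exponentials are discretized as series of q^k times the indicator of (k+1)
    A. Such a series is integrated termwise and gives Vol A times a constant common to all bodies,
    which cancels. The price is that gauges are rounded to integers; this costs a single factor q,
    and q may be taken arbitrarily close to 1. Intersecting K with K^o requires both to live in one
    space, although V and V^* carry different measures. Once both are transported to row vectors,
    the two measures differ by a constant factor, which cancels from the quotient. *)

(* Let M K = Vol K * Vol K^o. Choose a basis that is orthonormal for E1 and
   orthogonal for E2, and identify V with V^* through the ellipsoid E lying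
   halfway (geometrically) between E1 and E2. Then K^o also lies between E1 and
   E2, whereas E1 <= K & K^o <= E, so passing from K to K & K^o replaces r by its
   square root. The polar of K & K^o is the convex hull of K and K^o, and
     Vol (conv (A U B)) * Vol (A & B) <= 2^n * Vol A * Vol B,
   so that each step loses a factor 2^n, exactly as (2 log2 r)^n does. For r <= 4
   the trivial bound M K >= M E1 / r^n suffices, since r <= 2 log2 r there.
   The volume inequality comes from computing the integral of
   exp (- |x|_A - |y|_B) in the variables z = x + y and x: for fixed z the inner
   integral is at least exp (- |z|_conv) times that of exp (- 2 |w|_(A & B)).
   Ratios of volumes are never computed by determinants: uniqueness of the
   translation-invariant measure suffices. *)

(** * Translation-invariant Borel measures on R^n *)

Definition rVb (R : realType) (n : nat) :
    measurableType (@open 'rV[R]_n).-sigma :=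
  g_sigma_algebraType (@open 'rV[R]_n).

Section BorelRow.
Variables (R : realType) (n : nat).
Local Notation W := 'rV[R]_n.

Lemma open_rVb (A : set W) : open A -> measurable (A : set (rVb R n)).
Proof. by move=> oA; exact: sub_sigma_algebra. Qed.

Lemma closed_rVb (A : set W) : closed A -> measurable (A : set (rVb R n)).
Proof.
move=> cA; rewrite -[A]setCK; apply: measurableC; apply: open_rVb.
exact: closed_openC.
Qed.

Lemma compact_rVb (A : set W) : compact A -> measurable (A : set (rVb R n)).
Proof. by move=> cA; apply: closed_rVb; apply: compact_closed cA; exact: norm_hausdorff. Qed.

Lemma measurable_coord (i : 'I_n) :
  measurable_fun setT (fun x : rVb R n => (x : W) ord0 i).
Proof.
apply: (measurability _ (RGenOpens.measurableE R)).
move=> _ [_ [a [b ->] <-]]; rewrite setTI; apply: open_rVb.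
have /continuousP := @coord_continuous R 1 n ord0 i; apply.
exact: interval_open.
Qed.

Lemma fin_forall_measurable d (T : measurableType d) (P : 'I_n -> set T) :
  (forall i, measurable (P i)) -> measurable [set t | forall i, P i t].
Proof.
move=> mP; rewrite (_ : [set _ | _] = \bigcap_(i in [set: 'I_n]) P i).
  by apply: fin_bigcap_measurable.
by apply/seteqP; split=> t /= Pt i //; exact: Pt.
Qed.

(** An open set is a countable union of cubes with rational centre and radius, and the preimage of a
    cube is a finite intersection of coordinate conditions. In particular addition is measurable on
    [rVb R n * rVb R n], whose sigma-algebra is the product one and not the one generated by the
    open sets of the product. *)
Lemma measurable_rV d (T : measurableType d) (f : T -> rVb R n) :
  (forall i, measurable_fun setT (fun t => (f t : W) ord0 i)) ->
  measurable_fun setT f.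
Proof.
move=> mf; apply: (@measurability _ _ _ (rVb R n) setT f (@open W)) => //.
move=> _ [U oU <-]; rewrite setTI.
pose Q (u : 'rV[rat]_n * rat) : set W :=
  [set x : W | forall i, `|x ord0 i - ratr (u.1 ord0 i)| < ratr u.2].
have -> : f @^-1` U = \bigcup_u (if `[< Q u `<=` U >] then f @^-1` Q u else set0).
  apply/seteqP; split=> t /=; last first.
    by move=> [u _]; case: ifPn => // /asboolP QO Qt; exact: QO.
  move=> Ot; have /nbhs_ballP[e /= e0 eO] := open_nbhs_nbhs (conj oU Ot).
  (* Two points of a cube of radius [q] differ by less than 2 q < e in each coordinate. *)
  have [q] := rat_in_itvoo (divr_gt0 e0 (ltr0n _ 2)).
  rewrite in_itv/= => /andP[q0 qe].
  have H i : exists c : rat, `|(f t : W) ord0 i - ratr c| < ratr q.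
    have [|c] := @rat_in_itvoo R ((f t : W) ord0 i - ratr q) ((f t : W) ord0 i + ratr q).
      by lra.
    by rewrite in_itv/= => /andP[c1 c2]; exists c; rewrite ltr_norml; lra.
  pose c i := projT1 (cid (H i)).
  have Hc i : `|(f t : W) ord0 i - ratr (c i)| < ratr q by exact: (projT2 (cid (H i))).
  exists (\row_i c i, q) => //.
  rewrite ifT; first by move=> i /=; rewrite mxE.
  apply/asboolP => y Qy; apply: eO; split=> // i j; rewrite (ord1 i) /ball /=.
  have := Qy j; rewrite /= mxE => h1; have h2 := Hc j.
  rewrite (_ : _ - _ = ((f t : W) ord0 j - ratr (c j)) - (y ord0 j - ratr (c j))); last by ring.
  by apply: le_lt_trans (ler_normB _ _) _; lra.
apply: countable_bigcupT_measurable; first exact: countableP.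
move=> u; case: ifP => // _; apply: fin_forall_measurable => i.
have := mf i; move=> /(_ measurableT) /(_ [set y | `|y - ratr (u.1 ord0 i)| < ratr u.2]).
rewrite setTI; apply; apply: open_measurable.
rewrite (_ : [set _ | _] = ball (ratr (u.1 ord0 i) : R) (ratr u.2)); first exact: ball_open.
by apply/seteqP; split=> y /=; rewrite /ball /= distrC.
Qed.

Lemma continuous_rV (T : topologicalType) (f : T -> W) :
  (forall i, continuous (fun t => f t ord0 i)) -> continuous f.
Proof.
move=> cf t A [P Pn PA].
have : \forall s \near t, forall j, P ord0 j (f s ord0 j).
  by apply: filter_forall => j; apply: cf; exact: Pn.
by apply: filterS => s Ps; apply: PA => i j; rewrite (ord1 i).
Qed.

Lemma measurable_rVD :
  measurable_fun setT (fun p : rVb R n * rVb R n => (p.1 : W) + p.2 : rVb R n).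
Proof.
apply: measurable_rV => i.
rewrite (_ : (fun _ => _) = (fun p : rVb R n * rVb R n => (p.1 : W) ord0 i + (p.2 : W) ord0 i)).
  apply: measurable_funD; apply: (measurableT_comp (measurable_coord i)) => //.
by apply/funext => p; rewrite mxE.
Qed.

Lemma measurable_rVB :
  measurable_fun setT (fun p : rVb R n * rVb R n => (p.1 : W) - p.2 : rVb R n).
Proof.
apply: measurable_rV => i.
rewrite (_ : (fun _ => _) = (fun p : rVb R n * rVb R n => (p.1 : W) ord0 i - (p.2 : W) ord0 i)).
  apply: measurable_funB; apply: (measurableT_comp (measurable_coord i)) => //.
by apply/funext => p; rewrite !mxE.
Qed.

Lemma continuous_rVb (f : W -> W) :
  continuous f -> measurable_fun setT (f : rVb R n -> rVb R n).
Proof.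
move=> cf; apply: (@measurability _ _ (rVb R n) (rVb R n) setT f (@open W)) => //.
move=> _ [U oU <-]; rewrite setTI; apply: open_rVb.
by have /continuousP H := cf; exact: H.
Qed.

Definition box (a : R) : set W := [set x | forall i, `|x ord0 i| <= a].

Lemma box_compact a : compact (box a).
Proof.
rewrite (_ : box a = [set x : W | forall i, [set` `[- a, a]] (x ord0 i)]).
  apply: (@rV_compact R n (fun=> [set` `[- a, a]])) => i.
  exact: segment_compact.
by apply/seteqP; split=> x /= + i => /(_ i); rewrite ?in_itv/= ler_norml.
Qed.

Lemma cover_box : \bigcup_k box k%:R = setT.
Proof.
apply/seteqP; split=> // x _; exists (Num.truncn `|x|).+1 => // i.
rewrite (le_trans _ (ltW (truncnS_gt _)))//.
rewrite [leRHS]/Num.norm /= mx_normrE; apply/bigmax_geP; right.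
by exists (ord0, i).
Qed.

Definition haar (m : {measure set (rVb R n) -> \bar R}) : Prop :=
  [/\ forall (A : set (rVb R n)) (v : W), measurable A ->
        m [set (x : W) + v | x in A] = m A,
      forall K : set W, compact K -> (m K < +oo)%E
    & m setT != 0%E].

Section Haar.
Variable m : {measure set (rVb R n) -> \bar R}.
Hypothesis hm : haar m.

Lemma haar_fin (K : set W) : compact K -> m K \is a fin_num.
Proof. by move=> cK; rewrite ge0_fin_numE//; case: hm => _ + _; apply. Qed.

Lemma imageD (A : set W) v : [set x + v | x in A] = [set x | A (x - v)].
Proof.
apply/seteqP; split=> [_ [y Ay <-]|x /= Ax] /=; first by rewrite addrK.
by exists (x - v) => //; rewrite subrK.
Qed.

Lemma haarB (A : set (rVb R n)) (v : W) : measurable A ->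
  m [set x : rVb R n | A ((x : W) - v : W)] = m A.
Proof. by move=> mA; rewrite -imageD; case: hm => + _ _; apply. Qed.

Lemma haarD (A : set (rVb R n)) (v : W) : measurable A ->
  m [set x : rVb R n | A ((x : W) + v : W)] = m A.
Proof. by move=> mA; rewrite -[v]opprK haarB. Qed.

(** A copy of [m] that carries the proof [hm], so that the sigma-finite instance, which depends on
    [hm] and is required by Fubini, can be attached to it. *)
Definition haar_fun (_ : haar m) : set (rVb R n) -> \bar R := m.

HB.instance Definition _ := isMeasure.Build _ _ _ (haar_fun hm)
  (measure0 m) (measure_ge0 m) (@measure_semi_sigma_additive _ _ _ m).

Let haar_fun_sigma_finite : sigma_finite setT (haar_fun hm).
Proof.
exists (fun k => box k%:R); first by rewrite cover_box.
move=> k; split; first by apply: compact_rVb; exact: box_compact.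
by have [_ H _] := hm; apply: (H (box k%:R)); exact: box_compact.
Qed.

HB.instance Definition _ := Measure_isSigmaFinite.Build _ _ _ (haar_fun hm)
  haar_fun_sigma_finite.

Lemma haar_sigma_finite :
  exists m' : {sigma_finite_measure set (rVb R n) -> \bar R}, (m' : set _ -> _) = m.
Proof. by exists (haar_fun hm). Qed.

Lemma measurable_box a : measurable (box a : set (rVb R n)).
Proof. by apply: compact_rVb; exact: box_compact. Qed.

(** The translates of the box by rational vectors are countably many and cover the space; if the box
    were null, the whole space would be. *)
Lemma haar_box_gt0 a : 0 < a -> (0 < m (box a))%E.
Proof.
move=> a0; rewrite lt_neqAle measure_ge0 andbT eq_sym; apply/negP => /eqP ma.
case: hm => _ _ /negP; apply; apply/eqP.
pose F k : set (rVb R n) := if unpickle k is Some c then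
  [set x : rVb R n | box a ((x : W) - (map_mx ratr (c : 'rV[rat]_n) : W))] else set0.
have mF k : measurable (F k) /\ m (F k) = 0%E.
  rewrite /F; case: unpickle => [c|]; last by split; rewrite ?measure0.
  rewrite haarB ?ma; last exact: measurable_box.
  split=> //; rewrite -imageD; apply: compact_rVb.
  apply: continuous_compact; last exact: (@box_compact a).
  by apply: continuous_subspaceT => x; exact: (cvgD cvg_id (cvg_cst _)).
have : (m setT <= \sum_(k <oo) m (F k))%E.
  apply: measure_sigma_subadditive => // [k|]; first by case: (mF k).
  move=> x _.
  have H i : exists c : rat, `|(x : W) ord0 i - ratr c| <= a.
    have [|c] := @rat_in_itvoo R ((x : W) ord0 i - a) ((x : W) ord0 i + a); first by lra.
    by rewrite in_itv/= => /andP[c1 c2]; exists c; rewrite ler_norml; lra.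
  exists (pickle (\row_i projT1 (cid (H i)))) => //.
  rewrite /F pickleK => i; rewrite !mxE; exact: (projT2 (cid (H i))).
rewrite eseries0; last by move=> i _ _; case: (mF i).
by rewrite measure_le0 => /eqP.
Qed.

End Haar.

Lemma haar_fubini (m1 m2 : {measure set (rVb R n) -> \bar R}) (S : set (rVb R n * rVb R n)) :
  haar m1 -> haar m2 -> measurable S ->
  (\int[m1]_x m2 (xsection S x) = \int[m2]_y m1 (ysection S y))%E.
Proof.
move=> /haar_sigma_finite[m1' <-] /haar_sigma_finite[m2' <-] mS.
have := indic_fubini_tonelli m1' m2' mS.
by rewrite indic_fubini_tonelli_FE// indic_fubini_tonelli_GE.
Qed.

(* Fubini on {(x, y) | x in A, x + y in B}. *)
Lemma haar_unique (m1 m2 : {measure set (rVb R n) -> \bar R}) (A B : set (rVb R n)) :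
  haar m1 -> haar m2 -> measurable A -> measurable B ->
  (forall x : W, A x -> A (- x)) -> (m1 A * m2 B = m2 A * m1 B)%E.
Proof.
move=> h1 h2 mA mB sA.
have sAE (x : W) : A (- x) = A x.
  by apply/propext; split=> [/sA|/sA//]; rewrite opprK.
pose S : set (rVb R n * rVb R n) := [set p | A p.1 /\ B ((p.1 : W) + p.2 : W)].
pose S' : set (rVb R n * rVb R n) := [set p | B p.1 /\ A ((p.1 : W) - p.2 : W)].
have mS : measurable S.
  apply: measurableI; rewrite -[X in measurable X]setTI.
    exact: (measurable_fst measurableT).
  exact: (measurable_rVD measurableT).
have mS' : measurable S'.
  apply: measurableI; rewrite -[X in measurable X]setTI.
    exact: (measurable_fst measurableT).
  exact: (measurable_rVB measurableT).
(* For fixed y, the substitution of x for x + y carries one section to the other. *)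
have yS y : m1 (ysection S y) = m1 (ysection S' y).
  rewrite -(@haarD m1 h1 (ysection S' y) y); last exact: measurable_ysection.
  congr (m1 _); apply/seteqP; split=> x; rewrite /ysection /= !inE /S /S' /= addrK.
    by case.
  by case.
have -> : (m1 A * m2 B)%E = (\int[m1]_x m2 (xsection S x))%E.
  transitivity (\int[m1]_x (m2 B * (\1_A x)%:E))%E.
    rewrite ge0_integralZl//; last by apply/measurable_EFinP.
    by rewrite integral_indic// setIT muleC.
  apply: eq_integral => x _; rewrite indicE;
  case: (boolP (x \in A)); rewrite ?inE ?notin_setE => Ax.
    rewrite mule1 -(@haarD m2 h2 B x mB); congr (m2 _).
    apply/seteqP; split=> y; rewrite /xsection /= inE /S /= addrC; first by split.
    by case.
  rewrite mule0 (_ : xsection _ _ = set0) ?measure0//.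
  by apply/seteqP; split=> y //; rewrite /xsection /= inE /S /= => -[].
rewrite haar_fubini//; under eq_integral do rewrite yS.
rewrite -(haar_fubini h1 h2 mS').
transitivity (\int[m1]_x (m2 A * (\1_B x)%:E))%E; last first.
  rewrite ge0_integralZl//; last by apply/measurable_EFinP.
  by rewrite integral_indic// setIT.
apply: eq_integral => x _; rewrite indicE; case: (boolP (x \in B)); rewrite ?inE ?notin_setE => Bx.
  (* The symmetry of [A] turns the reflected set x - A into the translate x + A. *)
  rewrite mule1 -(@haarB m2 h2 A x mA); congr (m2 _).
  apply/seteqP; split=> y; rewrite /xsection /= inE /S' /=.
    by case=> _; rewrite -sAE opprB.
  by rewrite -sAE opprB.
rewrite mule0 (_ : xsection _ _ = set0) ?measure0//.
by apply/seteqP; split=> y //; rewrite /xsection /= inE /S' /= => -[].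
Qed.

Lemma haar_prop (m1 m2 : {measure set (rVb R n) -> \bar R}) (B : set (rVb R n)) :
  haar m1 -> haar m2 -> measurable B ->
  m2 B = ((fine (m2 (box 1)) / fine (m1 (box 1)))%:E * m1 B)%E.
Proof.
move=> h1 h2 mB.
have c1 := @box_compact 1.
have sb (x : W) : box 1 x -> box 1 (- x) by move=> bx i; rewrite mxE normrN.
have := haar_unique h1 h2 (measurable_box 1) mB sb.
have p1 := haar_box_gt0 h1 ltr01.
have f1 := haar_fin h1 c1; have f2 := haar_fin h2 c1.
rewrite -{1}(fineK f1) -{1}(fineK f2) => /(congr1 (fun z => ((fine (m1 (box 1)))^-1%:E * z)%E)).
have q1 : 0 < fine (m1 (box 1)) by rewrite fine_gt0// p1/= -ge0_fin_numE.
rewrite !muleA -!EFinM mulVf ?gt_eqF// mul1e => ->.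
by rewrite mulrC.
Qed.

End BorelRow.

(** * Diagonal dilations and the factors by which they change volume *)

Section Dilation.
Variables (R : realType) (n : nat).
Local Notation W := 'rV[R]_n.

(** Diagonal matrices are stored as rows, so that [dil] is both their action on vectors and their
    product. *)
Definition dil (d x : W) : W := \row_i (d ord0 i * x ord0 i).
Definition invr_row (d : W) : W := \row_i (d ord0 i)^-1.
Definition pos_row (d : W) := forall i, 0 < d ord0 i.

Lemma pos_row_inv d : pos_row d -> pos_row (invr_row d).
Proof. by move=> d0 i; rewrite mxE invr_gt0. Qed.

Lemma pos_row_dil d e : pos_row d -> pos_row e -> pos_row (dil d e).
Proof. by move=> d0 e0 i; rewrite mxE mulr_gt0. Qed.

Lemma pos_row_const (a : R) : 0 < a -> pos_row (const_mx a).
Proof. by move=> a0 i; rewrite mxE. Qed.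

Lemma dilC d e : dil d e = dil e d.
Proof. by apply/rowP => i; rewrite !mxE mulrC. Qed.

Lemma dilA c d x : dil c (dil d x) = dil (dil c d) x.
Proof. by apply/rowP => i; rewrite !mxE mulrA. Qed.

Lemma dil1 x : dil (const_mx 1) x = x.
Proof. by apply/rowP => i; rewrite !mxE mul1r. Qed.

Lemma dil_const a x : dil (const_mx a) x = a *: x.
Proof. by apply/rowP => i; rewrite !mxE. Qed.

Lemma dilV d : pos_row d -> dil (invr_row d) d = const_mx 1.
Proof. by move=> d0; apply/rowP => i; rewrite !mxE mulVf ?gt_eqF. Qed.

Lemma dilK d : pos_row d -> cancel (dil d) (dil (invr_row d)).
Proof. by move=> d0 x; rewrite dilA dilV ?dil1. Qed.

Lemma dilVK d : pos_row d -> cancel (dil (invr_row d)) (dil d).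
Proof. by move=> d0 x; rewrite dilA [dil d _]dilC dilV ?dil1. Qed.

Lemma invr_row_dil d e : invr_row (dil d e) = dil (invr_row d) (invr_row e).
Proof. by apply/rowP => i; rewrite !mxE invfM. Qed.

Lemma invr_rowK d : invr_row (invr_row d) = d.
Proof. by apply/rowP => i; rewrite !mxE invrK. Qed.

Lemma dil_continuous d : continuous (dil d).
Proof.
apply: continuous_rV => i; rewrite (_ : (fun _ => _) = (fun x : W => d ord0 i * x ord0 i)).
  by move=> x; exact: (cvgM (cvg_cst _) (@coord_continuous _ _ _ _ _ x)).
by apply/funext => x; rewrite mxE.
Qed.

Lemma measurable_dil d : measurable_fun setT (dil d : rVb R n -> rVb R n).
Proof. by apply: (@continuous_rVb R n (dil d)); exact: dil_continuous. Qed.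

Lemma measurable_dil_preimage d (A : set (rVb R n)) :
  measurable A -> measurable (dil d @^-1` A : set (rVb R n)).
Proof. by move=> mA; rewrite -[X in measurable X]setTI; exact: measurable_dil. Qed.

Lemma dil_preimage d (A : set W) : pos_row d ->
  dil d @^-1` A = dil (invr_row d) @` A.
Proof.
move=> d0; apply/seteqP; split=> [x Ax|_ [x Ax <-]] /=.
  by exists (dil d x) => //; rewrite dilK.
by rewrite dilVK.
Qed.

Lemma compact_dil d (A : set W) : pos_row d -> compact A -> compact (dil d @^-1` A).
Proof.
move=> d0 cA; rewrite dil_preimage//; apply: continuous_compact cA.
by apply: continuous_subspaceT; exact: dil_continuous.
Qed.

Lemma dilB d x y : dil d (x - y) = dil d x - dil d y.
Proof. by apply/rowP => i; rewrite !mxE mulrBr. Qed.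

Section Psi.
Variable m : {measure set (rVb R n) -> \bar R}.
Hypothesis hm : haar m.

Lemma haar_dil d (d0 : pos_row d) : exists m' : {measure set (rVb R n) -> \bar R},
  haar m' /\ forall A, m' A = m (dil d @^-1` A).
Proof.
have md := measurable_dil d.
pose m' : {measure set (rVb R n) -> \bar R} := pushforward m (dil d : rVb R n -> rVb R n).
exists (m' md); split=> //.
have [ht hc h0] := hm; split.
- move=> A v mA; rewrite /m' /pushforward.
  rewrite (imageD A v).
  apply: etrans (haarB hm (dil (invr_row d) v) (measurable_dil_preimage d mA)).
  by congr (m _); apply/seteqP; split => x /=; rewrite dilB dilVK.
- by move=> K cK; rewrite /m' /pushforward; apply: (hc (dil d @^-1` K)); exact: compact_dil.
- exact: h0.
Qed.

(* The product of the d_i^-1 (the modulus of the dilation); only its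
   multiplicativity and psi_natV are needed. *)
Definition psi (d : W) : R := fine (m (dil d @^-1` box 1)) / fine (m (box 1)).

Lemma fine_haar_box_gt0 a : 0 < a -> 0 < fine (m (box a)).
Proof.
move=> a0; rewrite fine_gt0// (haar_box_gt0 hm a0)/= -ge0_fin_numE//.
by apply: haar_fin => //; exact: box_compact.
Qed.

(** The pushforward of [m] under the dilation is again translation-invariant, hence a multiple of
    [m], and the factor is read off on the unit box. *)
Lemma psiE d (A : set (rVb R n)) : pos_row d -> measurable A ->
  m (dil d @^-1` A) = ((psi d)%:E * m A)%E.
Proof.
move=> d0 mA; have [m' [hm' m'E]] := haar_dil d0.
by rewrite -m'E (haar_prop hm hm' mA) m'E.
Qed.

Lemma psi_gt0 d : pos_row d -> 0 < psi d.
Proof.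
move=> d0; have [m' [hm' m'E]] := haar_dil d0.
rewrite /psi divr_gt0 ?fine_haar_box_gt0// -m'E fine_gt0//.
have c1 := @box_compact R n 1.
by rewrite (haar_box_gt0 hm')//= -ge0_fin_numE// haar_fin.
Qed.

Lemma psiM d e : pos_row d -> pos_row e -> psi (dil d e) = psi d * psi e.
Proof.
move=> d0 e0; have mb := @measurable_box R n 1.
have /eqP := psiE d0 (measurable_dil_preimage e mb).
rewrite (psiE e0)// muleA -EFinM.
have -> : dil d @^-1` (dil e @^-1` box 1) = dil (dil d e) @^-1` box 1 :> set W.
  by apply/seteqP; split => x /=; rewrite dilA [dil e d]dilC.
have dd := pos_row_dil d0 e0.
rewrite (psiE dd)// -(fineK (haar_fin hm (@box_compact R n 1))) -!EFinM eqe.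
by move=> /eqP/mulIf; apply; rewrite gt_eqF ?fine_haar_box_gt0.
Qed.

Lemma psi1 : psi (const_mx 1) = 1.
Proof.
rewrite /psi (_ : _ @^-1` _ = box 1).
  by rewrite divff ?gt_eqF ?fine_haar_box_gt0.
by apply/seteqP; split => x /=; rewrite dil1.
Qed.

Lemma psiV d : pos_row d -> psi (invr_row d) = (psi d)^-1.
Proof.
move=> d0; have p0 := psi_gt0 d0; apply: (mulIf (lt0r_neq0 p0)).
by rewrite -psiM ?dilV ?psi1 ?mulVf ?gt_eqF//; exact: pos_row_inv.
Qed.

Lemma box_cover k : (0 < k)%N ->
  box k%:R `<=` \bigcup_(c : {ffun 'I_n -> 'I_k})
    [set x : W | box 1 (x - \row_i ((c i)%:R *+ 2 + 1 - k%:R))].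
Proof.
case: k => // k _ x bx.
pose u i := (x ord0 i + k.+1%:R) / 2.
(* The minimum serves the endpoint [x ord0 i = k.+1%:R], where the integer part of [u i] is [k.+1],
   one beyond the last index. *)
exists [ffun i => inord (minn k (Num.truncn (u i)))] => // i.
have := bx i; rewrite ler_norml => /andP[x1 x2].
have u0 : 0 <= u i by rewrite /u; lra.
rewrite !mxE ffunE inordK ?ltnS ?geq_minl//.
have /andP[t1 t2] := truncn_itv u0.
have ux : x ord0 i = 2 * u i - k.+1%:R by rewrite /u; lra.
have uk : u i <= k.+1%:R by rewrite /u; lra.
rewrite ux ler_norml; case: (leqP k (Num.truncn (u i))) => kt.
  have {}kt : k%:R <= (Num.truncn (u i))%:R :> R by rewrite ler_nat.
  by rewrite -natr1 mulr2n in uk *; lra.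
by rewrite -natr1 mulr2n in t2 *; lra.
Qed.

(** The k^n translates of the unit box from [box_cover] cover [box k%:R]. This bound makes
    [gauge_cst] converge and, for k = 2, produces the factor 2^n of the Rogers-Shephard
    inequality. *)
Lemma psi_natV k : (0 < k)%N -> psi (const_mx k%:R^-1) <= k%:R ^+ n.
Proof.
move=> k0; have kp : 0 < k%:R :> R by rewrite ltr0n.
rewrite /psi ler_pdivrMr ?fine_haar_box_gt0//.
have -> : dil (const_mx k%:R^-1) @^-1` box 1 = box k%:R :> set W.
  apply/seteqP; split => x /= bx i; move: (bx i);
  by rewrite dil_const mxE normrM gtr0_norm ?invr_gt0// ler_pdivrMl ?mulr1.
pose F (c : {ffun 'I_n -> 'I_k}) : set (rVb R n) :=
  [set x : rVb R n | box 1 ((x : W) - (\row_i ((c i)%:R *+ 2 + 1 - k%:R) : W))].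
pose G (i : 'I_#|{ffun 'I_n -> 'I_k}|) := F (enum_val i).
have mF c : measurable (F c).
  rewrite /F -imageD; apply: compact_rVb.
  apply: continuous_compact; last exact: (@box_compact R n 1).
  by apply: continuous_subspaceT => x; exact: (cvgD cvg_id (cvg_cst _)).
have FE c : m (F c) = m (box 1) by rewrite /F haarB//; exact: measurable_box.
have : (m (box k%:R) <= \sum_(c \in [set: {ffun 'I_n -> 'I_k}]) m (F c))%E.
  apply: content_sub_fsum.
  - exact: finite_finset.
  - by move=> c _; exact: mF.
  - exact: (@measurable_box R n k%:R).
  - exact: box_cover.
rewrite (eq_fsbigr (fun=> m (box 1))); last by move=> c _; exact: FE.
rewrite -(fineK (haar_fin hm (@box_compact R n 1))) -(fineK (haar_fin hm (@box_compact R n k%:R))).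
rewrite (_ : [set: {ffun 'I_n -> 'I_k}] = [set` enum {ffun 'I_n -> 'I_k}]); last first.
  by apply/seteqP; split=> c //= _; rewrite mem_enum.
rewrite -fsbig_seq ?enum_uniq// sumEFin big_const_seq count_predT -cardT card_ffun !card_ord.
rewrite iter_addr_0 lee_fin => h.
by apply: le_trans h _; rewrite -[leLHS]mulr_natl natrX.
Qed.

End Psi.

End Dilation.

(** * The Rogers-Shephard inequality *)

Section DiscreteGauge.
Variables (R : realType) (n : nat).
Local Notation W := 'rV[R]_n.
Variable q : R.
Hypotheses (q0 : 0 < q) (q1 : q < 1).

Definition level (A : set W) (k : nat) : set (rVb R n) :=
  [set x | A (k.+1%:R^-1 *: (x : W))].

(* A discrete version of exp(- gauge): up to the factor (1 - q)^-1 it is q ^ k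
   where k.+1 is the least integer s with x in s A. *)
Definition dgauge (A : set W) (x : rVb R n) : \bar R :=
  (\sum_(k <oo) (q ^+ k * \1_(level A k) x)%:E)%E.

Let term_ge0 (A : set W) k x : (0 <= (q ^+ k * \1_(level A k) x)%:E)%E.
Proof. by rewrite lee_fin mulr_ge0 ?exprn_ge0// ltW. Qed.

Lemma dgauge_ge0 A x : (0 <= dgauge A x)%E.
Proof. by apply: nneseries_ge0 => k _ _; exact: term_ge0. Qed.

Lemma geometric_tail j :
  (\sum_(k <oo) (q ^+ k * (j <= k)%N%:R)%:E = (q ^+ j * (1 - q)^-1)%:E)%E.
Proof.
have t0 k : (0 <= (q ^+ k * (j <= k)%N%:R)%:E)%E.
  by rewrite lee_fin mulr_ge0 ?exprn_ge0// ltW.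
rewrite (nneseries_split 0 j)// big1_seq ?add0e ?add0n; last first.
  by move=> k; rewrite mem_index_iota /= => kj; rewrite leqNgt kj mulr0.
rewrite -nneseries_addn//.
under eq_eseriesr => k _ do rewrite leq_addl mulr1 addnC exprD.
have -> : (fun k => \sum_(0 <= i < k) (q ^+ j * q ^+ i)%:E)%E =
    EFin \o series (geometric (q ^+ j) q).
  by apply/funext => k /=; rewrite /series /= -sumEFin.
apply/cvg_lim => //; apply: cvg_EFin; first by apply: nearW.
by apply: cvg_geometric_series; rewrite ger0_norm // ltW.
Qed.

Lemma dgauge_ge (A : set W) x j :
  (forall k, (j <= k)%N -> level A k x) ->
  ((q ^+ j * (1 - q)^-1)%:E <= dgauge A x)%E.
Proof.
move=> Ax; rewrite -geometric_tail; apply: lee_nneseries => [k _|k _].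
  by rewrite lee_fin mulr_ge0 ?exprn_ge0// ltW.
rewrite lee_fin ler_pM2l ?exprn_gt0// indicE.
by case: leqP => // jk; rewrite mem_set//; exact: Ax.
Qed.

Lemma dgauge_le (A : set W) x j :
  (forall k, (k < j)%N -> ~ level A k x) ->
  (dgauge A x <= (q ^+ j * (1 - q)^-1)%:E)%E.
Proof.
move=> Ax; rewrite -geometric_tail; apply: lee_nneseries => [k _ _|k _]; first exact: term_ge0.
rewrite lee_fin ler_pM2l ?exprn_gt0// indicE.
by case: leqP => [_|jk]; [case: (_ \in _)|rewrite memNset//; exact: Ax].
Qed.

Lemma dgauge_eq0 (A : set W) x : (forall k, ~ level A k x) -> dgauge A x = 0%E.
Proof.
by move=> Ax; apply: eseries0 => k _ _; rewrite indicE memNset ?mulr0//; exact: Ax.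
Qed.

Lemma measurable_level (A : set W) k :
  measurable (A : set (rVb R n)) -> measurable (level A k).
Proof.
move=> mA; rewrite (_ : level A k = dil (const_mx k.+1%:R^-1) @^-1` A).
  exact: measurable_dil_preimage.
by apply/seteqP; split => x /=; rewrite /level/= dil_const.
Qed.

Lemma measurable_dgauge (A : set W) :
  measurable (A : set (rVb R n)) -> measurable_fun setT (dgauge A).
Proof.
move=> mA; apply: ge0_emeasurable_sum => [k x _ _|k _]; first exact: term_ge0.
apply/measurable_EFinP; apply: measurable_funM => //.
by apply: measurable_indic; exact: measurable_level.
Qed.

Section Integral.
Variable m : {measure set (rVb R n) -> \bar R}.
Hypothesis hm : haar m.

Definition gauge_cst : \bar R :=
  (\sum_(k <oo) (q ^+ k * psi m (const_mx k.+1%:R^-1))%:E)%E.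

(** The factor [gauge_cst] does not depend on [A]; it therefore cancels from an inequality with two
    gauges on either side. *)
Lemma integral_dgauge (A : set W) : measurable (A : set (rVb R n)) ->
  m A \is a fin_num -> (\int[m]_x dgauge A x = gauge_cst * m A)%E.
Proof.
move=> mA fA; rewrite integral_nneseries//; last first.
  move=> k; apply/measurable_EFinP; apply: measurable_funM => //.
  by apply: measurable_indic; exact: measurable_level.
rewrite /gauge_cst muleC -(fineK fA) -nneseriesZl//; last first.
  move=> k _; rewrite lee_fin mulr_ge0 ?exprn_ge0 ?ltW//.
  by apply: psi_gt0 => //; apply: pos_row_const; rewrite invr_gt0.
apply: eq_eseriesr => k _.
under eq_integral do rewrite EFinM.
rewrite ge0_integralZl//; last 2 first.
- by apply/measurable_EFinP; apply: measurable_indic; exact: measurable_level.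
- by rewrite lee_fin exprn_ge0// ltW.
rewrite integral_indic//; last exact: measurable_level.
rewrite setIT (_ : level A k = dil (const_mx k.+1%:R^-1) @^-1` A); last first.
  by apply/seteqP; split => x /=; rewrite /level/= dil_const.
rewrite psiE//; last by apply: pos_row_const; rewrite invr_gt0.
by rewrite (fineK fA) EFinM muleA muleC.
Qed.

Lemma gauge_cst_gt0 : (0 < gauge_cst)%E.
Proof.
have p0 k : 0 < psi m (const_mx k.+1%:R^-1).
  by apply: psi_gt0 => //; apply: pos_row_const; rewrite invr_gt0.
apply: lt_le_trans (nneseries_lim_ge 1 _).
  by rewrite big_nat1 lte_fin mulr_gt0// exprn_gt0.
by move=> k _; rewrite lee_fin mulr_ge0 ?exprn_ge0 ?ltW.
Qed.

(** By [psi_natV] the terms are at most q^k (k+1)^n. Writing q = e^(-2h), one factor e^(-hk) absorbs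
    the power of k+1 and the other leaves a geometric series. *)
Lemma gauge_cst_fin : (gauge_cst < +oo)%E.
Proof.
pose h := - ln q / 2.
have h0 : 0 < h by rewrite /h divr_gt0// oppr_gt0 ln_lt0// q0.
(* Since n a <= h, the bound t <= e^t gives (a s)^n <= e^(n a s) <= e^(h s); [n.+1] avoids dividing
   by zero when n = 0. *)
pose a := h / n.+1%:R.
have a0 : 0 < a by rewrite divr_gt0.
pose M := expR h / a ^+ n.
have M0 : 0 < M by rewrite divr_gt0 ?expR_gt0 ?exprn_gt0.
have qE : q = expR (- h) * expR (- h).
  by rewrite -expRD (_ : _ + _ = ln q) ?lnK// /h; lra.
have bnd k : q ^+ k * psi m (const_mx k.+1%:R^-1) <= M * expR (- h) ^+ k.
  have p := psi_natV hm (ltn0Sn k).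
  have ak : 0 < a * k.+1%:R by rewrite mulr_gt0.
  have e1 : (a * k.+1%:R) ^+ n <= expR (h * k.+1%:R).
    have : a * k.+1%:R <= expR (a * k.+1%:R).
      by apply: le_trans (expR_ge1Dx _); lra.
    move=> /(lerXn2r n (ltW ak) (ltW (expR_gt0 _))) /le_trans; apply.
    rewrite -expRM_natl ler_expR mulrA ler_pM2r// /a mulrCA.
    by rewrite ler_piMr ?(ltW h0)// ler_pdivrMr// mul1r ler_nat ltnW.
  have e2 : k.+1%:R ^+ n <= M * expR h ^+ k.
    rewrite /M mulrAC ler_pdivlMr ?exprn_gt0// -exprMn mulrC.
    apply: le_trans e1 _.
    by rewrite -expRM_natl -expRD ler_expR -natr1; lra.
  apply: le_trans (_ : q ^+ k * (M * expR h ^+ k) <= _).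
    by rewrite ler_pM2l ?exprn_gt0//; exact: le_trans p e2.
  rewrite mulrCA -exprMn (_ : q * expR h = expR (- h))//.
  by rewrite {1}qE -mulrA -expRD addNr expR0 mulr1.
apply: le_lt_trans (_ : (\sum_(k <oo) (M * expR (- h) ^+ k)%:E < +oo)%E).
  apply: lee_nneseries => k _; last by rewrite lee_fin.
  rewrite lee_fin mulr_ge0 ?exprn_ge0 ?ltW//.
  by apply: psi_gt0 => //; apply: pos_row_const; rewrite invr_gt0.
have -> : (fun k => \sum_(0 <= i < k) (M * expR (- h) ^+ i)%:E)%E =
    EFin \o series (geometric M (expR (- h))).
  by apply/funext => k /=; rewrite /series /= -sumEFin.
have e1 : expR (- h) < 1 by rewrite -expR0 ltr_expR; lra.
have cv : series (geometric M (expR (- h))) @ \oo --> M * (1 - expR (- h))^-1.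
  by apply: cvg_geometric_series; rewrite ger0_norm ?expR_ge0.
rewrite (@cvg_lim _ _ _ _ _ _ (M * (1 - expR (- h))^-1)%:E) ?ltry//.
by apply: cvg_EFin => //; apply: nearW.
Qed.

End Integral.
End DiscreteGauge.

(** * Convolution of two gauges *)

Section RogersShephard.
Variables (R : realType) (n : nat).
Local Notation W := 'rV[R]_n.

Definition cvx (A : set W) := forall x y t,
  0 <= t <= 1 -> A x -> A y -> A (t *: x + (1 - t) *: y).

(** Subadditivity of the gauge in terms of levels: the point is a convex combination of [a] and [b],
    shrunk towards 0 because K may exceed s + v. *)
Lemma cvx_comb (A : set W) a b s v K : cvx A -> A 0 -> A a -> A b ->
  0 <= s -> 0 < v -> s + v <= K -> A (K^-1 *: (s *: a + v *: b)).
Proof.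
move=> cA A0 Aa Ab s0 v0 svK; have sv0 : 0 < s + v by lra.
have K0 : 0 < K by lra.
have Ac := @cA a b (s / (s + v)) _ Aa Ab.
have /(cA _ _ ((s + v) / K) _)/(_ A0) : A (s / (s + v) *: a + (1 - s / (s + v)) *: b).
  by apply: Ac; rewrite divr_ge0 ?(ltW sv0)//= ler_pdivrMr// mul1r; lra.
rewrite divr_ge0 ?(ltW sv0) ?(ltW K0)//= ler_pdivrMr// mul1r => /(_ svK).
rewrite scaler0 addr0; congr (A _); rewrite !scalerDr !scalerA.
by congr (_ *: _ + _ *: _); field; rewrite !gt_eqF.
Qed.

Lemma ceil_nat (u : R) : 0 < u -> exists k : nat, u <= k.+1%:R < u + 1.
Proof.
move=> u0.
have ex : exists k : nat, u <= k.+1%:R by exists (Num.truncn u); exact/ltW/truncnS_gt.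
case: (ex_minnP ex) => k uk mink; exists k; rewrite uk/=.
case: k uk mink => [|k] uk mink; first by lra.
rewrite -natr1 ltrD2r ltNge; apply/negP => /mink.
by rewrite ltnn.
Qed.

Lemma dgauge_le_least (q : R) (A : set W) x : 0 < q -> q < 1 ->
  dgauge q A x = 0%E \/
  exists2 k, level A k x & (dgauge q A x <= (q ^+ k * (1 - q)^-1)%:E)%E.
Proof.
move=> q0 q1; case: (pselect (exists k, level A k x)) => [ex|nex]; last first.
  by left; apply: dgauge_eq0 => k Ak; apply: nex; exists k.
right; have exb : exists k, `[< level A k x >] by case: ex => k Ak; exists k; exact/asboolP.
case: (ex_minnP exb) => k /asboolP Ak kmin; exists k => //.
apply: dgauge_le => // j jk Aj; have /asboolP/kmin := Aj.
by rewrite leqNgt jk.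
Qed.

Variable m : {measure set (rVb R n) -> \bar R}.
Hypothesis hm : haar m.

Lemma haar_integralD (f : rVb R n -> \bar R) (v : W) :
  measurable_fun setT f -> (forall x, 0 <= f x)%E ->
  (\int[m]_x f ((x : W) + v : W)%R = \int[m]_x f x)%E.
Proof.
move=> mf f0.
have mt : measurable_fun setT (fun x : rVb R n => (x : W) + v : rVb R n).
  apply: (@continuous_rVb R n (fun x : W => x + v)) => x.
  exact: (cvgD cvg_id (cvg_cst _)).
rewrite -[LHS](@ge0_integral_pushforward _ _ _ _ _ _ mt m setT)//.
apply: eq_measure_integral => A mA _; exact: (haarD hm v mA).
Qed.

Lemma haar_fubini_tonelli (f : rVb R n * rVb R n -> \bar R) :
  measurable_fun setT f -> (forall x, 0 <= f x)%E ->
  (\int[m]_x \int[m]_y f (x, y) = \int[m]_y \int[m]_x f (x, y))%E.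
Proof.
move=> mf f0; have [m' m'E] := haar_sigma_finite hm.
by rewrite -m'E; exact: fubini_tonelli.
Qed.

Lemma haar_measurable_int (f : rVb R n * rVb R n -> \bar R) :
  measurable_fun setT f -> (forall x, 0 <= f x)%E ->
  measurable_fun setT (fun y => \int[m]_x f (x, y))%E.
Proof.
move=> mf f0; have [m' m'E] := haar_sigma_finite hm.
by rewrite -m'E; exact: measurable_fun_fubini_tonelli_G.
Qed.

Variables A B C L : set W.
Hypotheses (mA : measurable (A : set (rVb R n))) (mB : measurable (B : set (rVb R n))).
Hypotheses (mC : measurable (C : set (rVb R n))) (mL : measurable (L : set (rVb R n))).
Hypotheses (fA : m A \is a fin_num) (fB : m B \is a fin_num).
Hypotheses (fC : m C \is a fin_num) (fL : m L \is a fin_num).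
Hypotheses (cA : cvx A) (cB : cvx B) (A0 : A 0) (B0 : B 0).
Hypotheses (LA : forall w, L w -> A w) (LB : forall w, L w -> B (- w)).
Hypothesis HC : forall z, C z -> exists a b t,
  [/\ 0 <= t <= 1, A a, B b & z = t *: a + (1 - t) *: b].

Let L2 : set W := [set w | L (2 *: w)].

Let mL2 : measurable (L2 : set (rVb R n)).
Proof.
rewrite (_ : L2 = dil (const_mx 2) @^-1` L).
  exact: measurable_dil_preimage.
by apply/seteqP; split => x /=; rewrite /L2/= dil_const.
Qed.

Let L2E : m L2 = ((psi m (const_mx 2))%:E * m L)%E.
Proof.
rewrite -psiE//; last by apply: pos_row_const.
by congr (m _); apply/seteqP; split => x /=; rewrite /L2/= dil_const.
Qed.

Section Fixed.
Variable q : R.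
Hypotheses (q0 : 0 < q) (q1 : q < 1).
Local Notation G := (dgauge q).

Let g0 : 0 < (1 - q)^-1. Proof. by rewrite invr_gt0 subr_gt0. Qed.

(* If z = x + y realizes the gauge of z, then moving by w costs at most |w|_A in
   the first factor and |w|_B in the second; the extra q pays for the rounding
   to integers, and L2 = L / 2 absorbs the sum of the two costs. *)
Lemma convolution_ge (z : W) :
  (q%:E * G C z * \int[m]_w G L2 w <= \int[m]_x (G A x * G B (z - (x : W) : W)%R))%E.
Proof.
have int0 : (0 <= \int[m]_x (G A x * G B (z - (x : W) : W)%R))%E.
  by apply: integral_ge0 => x _; apply: mule_ge0; exact: dgauge_ge0.
have [->|[k Ck Gk]] := @dgauge_le_least q C z q0 q1; first by rewrite mule0 mul0e.
have [a [b [t [/andP[t0 t1] Aa Bb zE]]]] := HC Ck.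
pose s := k.+1%:R * t; pose s' := k.+1%:R * (1 - t).
have s0 : 0 <= s by rewrite mulr_ge0.
have s'0 : 0 <= s' by rewrite mulr_ge0//; lra.
have ss' : s + s' = k.+1%:R by rewrite /s /s'; ring.
have {}zE : z = s *: a + s' *: b.
  rewrite -[LHS](scalerKV (lt0r_neq0 (ltr0Sn R k))) zE scalerDr !scalerA.
  by [].
pose f (x : rVb R n) := (G A x * G B (z - (x : W) : W)%R)%E.
have mGB : measurable_fun setT (fun x : rVb R n => G B (z - (x : W) : W)%R).
  apply: (measurableT_comp (measurable_dgauge q0 mB)).
  apply: (@continuous_rVb R n (fun x : W => z - x)) => x.
  exact: (cvgB (cvg_cst _) cvg_id).
have mf : measurable_fun setT f.
  by apply: emeasurable_funM => //; exact: measurable_dgauge.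
(* Recentre at the splitting x = s a, y = s' b of [z]; from here on [w] is the displacement from
   it. *)
rewrite -(haar_integralD (s *: a) mf); last first.
  by move=> x; apply: mule_ge0; exact: dgauge_ge0.
have k0 : (0 <= q%:E * G C z)%E.
  by apply: mule_ge0; [rewrite lee_fin ltW|exact: dgauge_ge0].
have L0 w : setT w -> (0 <= G L2 w)%E by move=> _; exact: dgauge_ge0.
have <- := ge0_integralZl m measurableT (measurable_dgauge q0 mL2) L0 k0.
apply: ge0_le_integral; first exact: measurableT.
- by move=> w _; apply: mule_ge0; [exact: k0|exact: dgauge_ge0].
- by apply: emeasurable_funM => //; exact: measurable_dgauge.
- apply: (@measurableT_comp _ _ _ _ _ _ f) => //.
  apply: (@continuous_rVb R n (fun x : W => x + s *: a)) => x.
  exact: (cvgD cvg_id (cvg_cst _)).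
move=> w _; rewrite /f.
have [->|[j Lj Gj]] := @dgauge_le_least q L2 w q0 q1.
  by rewrite mule0; apply: mule_ge0; exact: dgauge_ge0.
pose l : W := 2 *: (j.+1%:R^-1 *: (w : W)).
have Ll : L l by [].
pose v : R := j.+1%:R / 2.
have v0 : 0 < v by rewrite divr_gt0.
have wE : (w : W) = v *: l.
  rewrite /l !scalerA (_ : _ * _ = 1) ?scale1r//.
  by rewrite /v mulrA divfK ?mulfV ?pnatr_eq0.
have [k1 /andP[k1a k1b]] := @ceil_nat (s + v) ltac:(lra).
have [k2 /andP[k2a k2b]] := @ceil_nat (s' + v) ltac:(lra).
(* Each rounding adds less than 1, so (k1+1) + (k2+1) < (k+1) + (j+1) + 2; as these are integers,
   only one extra power of [q] is lost. *)
have kk : (k1 + k2 <= k + j + 1)%N.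
  have vv : v + v = j.+1%:R by rewrite /v; lra.
  have : (k1.+1 + k2.+1)%:R < (k.+1 + j.+1 + 2)%:R :> R by rewrite !natrD; lra.
  by rewrite ltr_nat !addSn !addnS !addn0 !ltnS.
have GA : ((q ^+ k1 * (1 - q)^-1)%:E <= G A ((w : W) + s *: a : W)%R)%E.
  apply: dgauge_ge => // i ki; rewrite /level /= wE addrC.
  apply: cvx_comb => //; first exact: LA.
  by apply: le_trans k1a _; rewrite ler_nat.
have GB : ((q ^+ k2 * (1 - q)^-1)%:E <= G B (z - ((w : W) + s *: a) : W)%R)%E.
  apply: dgauge_ge => // i ki; rewrite /level /=.
  have -> : z - ((w : W) + s *: a) = s' *: b + v *: (- l).
    by rewrite zE {1}wE scalerN [v *: l + _]addrC opprD addrACA subrr add0r.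
  apply: cvx_comb => //; first exact: LB.
  by apply: le_trans k2a _; rewrite ler_nat.
apply: le_trans (_ : ((q * (q ^+ k * (1 - q)^-1) * (q ^+ j * (1 - q)^-1))%:E <= _)%E).
  rewrite !EFinM; apply: lee_pmul => //.
  - exact: dgauge_ge0.
  - by rewrite -EFinM; apply: lee_pmul => //; [rewrite lee_fin ltW|exact: dgauge_ge0].
apply: le_trans (lee_pmul _ _ GA GB); last 2 first.
- by rewrite lee_fin mulr_ge0// ?exprn_ge0 ?ltW.
- by rewrite lee_fin mulr_ge0// ?exprn_ge0 ?ltW.
rewrite -EFinM lee_fin.
rewrite [leLHS](_ : _ = q ^+ (k + j + 1) * ((1 - q)^-1 * (1 - q)^-1)); last first.
  by rewrite !exprD expr1; ring.
rewrite [leRHS](_ : _ = q ^+ (k1 + k2) * ((1 - q)^-1 * (1 - q)^-1)); last first.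
  by rewrite !exprD; ring.
rewrite ler_pM2r ?mulr_gt0//.
by apply: ler_wiXn2l => //; exact: ltW.
Qed.

Lemma rogers_shephard_q :
  q * (fine (m C) * fine (m L)) <= 2 ^+ n * (fine (m A) * fine (m B)).
Proof.
pose c := gauge_cst q m.
have c0 : (0 < c)%E by exact: gauge_cst_gt0.
have cf : c \is a fin_num by rewrite ge0_fin_numE ?ltW// gauge_cst_fin.
have fL2 : m L2 \is a fin_num by rewrite L2E fin_numM.
have IC := integral_dgauge q0 hm mC fC.
have IA := integral_dgauge q0 hm mA fA.
have IB := integral_dgauge q0 hm mB fB.
have IL := integral_dgauge q0 hm mL2 fL2.
have mGA := measurable_dgauge q0 mA.
have mGB := measurable_dgauge q0 mB.
pose F (p : rVb R n * rVb R n) := (G A p.1 * G B ((p.2 : W) - (p.1 : W) : W)%R)%E.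
have mF : measurable_fun setT F.
  apply: emeasurable_funM; first exact: (measurableT_comp mGA).
  apply: (measurableT_comp mGB).
  apply: (measurableT_comp (@measurable_rVB R n)
    (_ : measurable_fun setT (fun p : rVb R n * rVb R n => (p.2, p.1)))).
  exact: measurable_fun_pair.
have F0 p : (0 <= F p)%E by apply: mule_ge0; exact: dgauge_ge0.
have key : (q%:E * (c * m C) * (c * m L2) <= (c * m A) * (c * m B))%E.
  rewrite -IC -IA -IB -IL.
  apply: le_trans (_ : (\int[m]_z \int[m]_x (G A x * G B ((z : W) - (x : W) : W)%R) <= _)%E).
    have mGC := measurable_dgauge q0 mC.
    have G0 z : setT z -> (0 <= G C z)%E by move=> _; exact: dgauge_ge0.
    have q0E : (0 <= q%:E)%E by rewrite lee_fin ltW.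
    have <- := ge0_integralZl m measurableT mGC G0 q0E.
    have mqGC : measurable_fun setT (fun z => q%:E * G C z)%E by exact: emeasurable_funM.
    have qG0 z : setT z -> (0 <= q%:E * G C z)%E.
      by move=> _; apply: mule_ge0 => //; exact: G0.
    have I0 : (0 <= \int[m]_w G L2 w)%E by apply: integral_ge0 => x _; exact: dgauge_ge0.
    have <- := ge0_integralZr m measurableT mqGC qG0 I0.
    apply: ge0_le_integral => //.
    - by move=> z _; apply: mule_ge0 => //; exact: qG0.
    - exact: emeasurable_funM.
    - by apply: (@haar_measurable_int F); [exact: mF|exact: F0].
    - by move=> z _; exact: convolution_ge.
  (* After the exchange, the inner integral is that of a translate of [G B], so the double integral
     factors. *)
  rewrite -(@haar_fubini_tonelli F mF F0).
  have GA0 x : setT x -> (0 <= G A x)%E by move=> _; exact: dgauge_ge0.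
  have IB0 : (0 <= \int[m]_w G B w)%E by apply: integral_ge0 => x _; exact: dgauge_ge0.
  have <- := ge0_integralZr m measurableT mGA GA0 IB0.
  apply: ge0_le_integral => //.
  - by move=> x _; apply: integral_ge0 => z _; exact: F0.
  - have mF' : measurable_fun setT (F \o (fun p => (p.2, p.1))).
      by apply: (measurableT_comp mF); apply: measurable_fun_pair.
    exact: (@haar_measurable_int (F \o (fun p => (p.2, p.1))) mF' (fun p => F0 _)).
  - by apply: emeasurable_funM.
  move=> x _; rewrite /F /=.
  have mGBx : measurable_fun setT (fun z : rVb R n => G B ((z : W) + (- (x : W)) : W)%R).
    apply: (measurableT_comp mGB).
    apply: (@continuous_rVb R n (fun z : W => z - (x : W))) => z.
    exact: (cvgB cvg_id (cvg_cst _)).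
  have GB0 z : setT z -> (0 <= G B ((z : W) + (- (x : W)) : W)%R)%E.
    by move=> _; exact: dgauge_ge0.
  rewrite (ge0_integralZl m measurableT mGBx GB0 (dgauge_ge0 q0 A x)).
  by rewrite haar_integralD// => z; exact: dgauge_ge0.
(* The origin of 2^n: [L2] is [L] halved, so its volume is at least 2^-n times that of [L]. *)
have p2 : 2 ^- n <= psi m (const_mx 2).
  have pc : pos_row (const_mx 2 : W) by apply: pos_row_const.
  have -> : const_mx 2 = invr_row (const_mx 2^-1) :> W.
    by apply/rowP => i; rewrite !mxE invrK.
  rewrite psiV//; last by apply: pos_row_const; rewrite invr_gt0.
  rewrite lef_pV2 ?posrE ?exprn_gt0//; first exact: psi_natV.
  by apply: psi_gt0 => //; apply: pos_row_const; rewrite invr_gt0.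
move: key; rewrite L2E -(fineK cf) -(fineK fA) -(fineK fB) -(fineK fC) -(fineK fL).
rewrite -!EFinM lee_fin.
have r0 : 0 < fine c by rewrite fine_gt0// c0/= -ge0_fin_numE// ltW.
have C0 : 0 <= fine (m C) by exact: fine_ge0.
have L0 : 0 <= fine (m L) by exact: fine_ge0.
move: (fine c) (fine (m A)) (fine (m B)) (fine (m C)) (fine (m L)) (psi _ _) r0 C0 L0 p2.
move=> r a b x y p r0 x0 y0 p2 H.
have {}H : q * x * (p * y) <= a * b.
  rewrite -(ler_pM2l (mulr_gt0 r0 r0)).
  by rewrite [leLHS](_ : _ = q * (r * x) * (r * (p * y))) ?[leRHS](_ : _ = r * a * (r * b))//; ring.
rewrite -ler_pdivrMl ?exprn_gt0//; apply: le_trans H.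
rewrite (_ : q * x * (p * y) = p * (q * (x * y))); last by ring.
by apply: ler_wpM2r => //; rewrite !mulr_ge0// ltW.
Qed.

End Fixed.

Lemma rogers_shephard :
  fine (m C) * fine (m L) <= 2 ^+ n * (fine (m A) * fine (m B)).
Proof.
set X := 2 ^+ n * _; set Y := _ * _.
have X0 : 0 <= X by rewrite !mulr_ge0 ?exprn_ge0// fine_ge0.
rewrite leNgt; apply/negP => XY.
have Y0 : 0 < Y by lra.
(* Any [q] strictly between X / Y and 1 contradicts [rogers_shephard_q]; the midpoint is taken. *)
pose q := (X / Y + 1) / 2.
have XY1 : X / Y < 1 by rewrite ltr_pdivrMr// mul1r.
have XY0 : 0 <= X / Y by rewrite divr_ge0// ltW.
have := @rogers_shephard_q q ltac:(rewrite /q; lra) ltac:(rewrite /q; lra).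
rewrite -/X -/Y leNgt => /negP; apply.
by rewrite /q -ltr_pdivrMr//; lra.
Qed.

End RogersShephard.

(** * Polar bodies and ellipsoids *)

Section Polarity.
Variables (R : realType) (n : nat).
Local Notation W := 'rV[R]_n.
Implicit Types (x y z u : W) (A B C D K : set W).

Definition dot (x y : W) : R := \sum_i x ord0 i * y ord0 i.

Lemma dotC x y : dot x y = dot y x.
Proof. by apply: eq_bigr => i _; rewrite mulrC. Qed.

Lemma dotDr x y z : dot x (y + z) = dot x y + dot x z.
Proof. by rewrite -big_split; apply: eq_bigr => i _; rewrite mxE mulrDr. Qed.

Lemma dotZr c x y : dot x (c *: y) = c * dot x y.
Proof. by rewrite mulr_sumr; apply: eq_bigr => i _; rewrite mxE mulrCA. Qed.

Lemma dotNr x y : dot x (- y) = - dot x y.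
Proof. by rewrite -scaleN1r dotZr mulN1r. Qed.

Lemma dotDl x y z : dot (x + y) z = dot x z + dot y z.
Proof. by rewrite dotC dotDr !(dotC z). Qed.

Lemma dotZl c x y : dot (c *: x) y = c * dot x y.
Proof. by rewrite dotC dotZr dotC. Qed.

Lemma dotNl x y : dot (- x) y = - dot x y.
Proof. by rewrite dotC dotNr dotC. Qed.

Lemma dot_ge0 x : 0 <= dot x x.
Proof. by apply: sumr_ge0 => i _; rewrite -expr2 sqr_ge0. Qed.

Lemma dot0_eq0 x : dot x x = 0 -> x = 0.
Proof.
move=> /eqP; rewrite psumr_eq0 => [/allP x0|i _]; last by rewrite -expr2 sqr_ge0.
apply/rowP => i; rewrite mxE; apply/eqP.
by have := x0 i (mem_index_enum _); rewrite -expr2 sqrf_eq0.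
Qed.

Lemma dot_sqrDZ s x y :
  dot (x + s *: y) (x + s *: y) = dot x x + 2 * s * dot x y + s ^+ 2 * dot y y.
Proof. by rewrite !(dotDl, dotDr, dotZl, dotZr) (dotC y x); ring. Qed.

Lemma dot_dil d x y : dot (dil d x) y = dot x (dil d y).
Proof. by apply: eq_bigr => i _; rewrite !mxE mulrCA mulrA. Qed.

Lemma continuous_sum (T : topologicalType) (f : 'I_n -> T -> R) :
  (forall i, continuous (f i)) -> continuous (fun t => \sum_i f i t).
Proof.
move=> cf; apply: continuous_big => // x; exact: add_continuous.
Qed.

Lemma dot_continuous2 (T : topologicalType) (f g : T -> W) :
  continuous f -> continuous g -> continuous (fun t => dot (f t) (g t)).
Proof.
move=> cf cg; apply: continuous_sum => i t.
apply: cvgM; first exact: (cvg_comp _ _ (cf t) (@coord_continuous _ _ _ _ _ _)).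
exact: (cvg_comp _ _ (cg t) (@coord_continuous _ _ _ _ _ _)).
Qed.

Lemma dot_continuous x : continuous (dot x).
Proof.
by apply: (@dot_continuous2 _ (fun=> x) id) => t; [exact: cst_continuous|exact: cvg_id].
Qed.

Definition pol K : set W := [set y | forall x, K x -> `|dot x y| <= 1].

(** For a symmetric convex set, having nonempty interior is the same as containing a box around 0,
    and the box gives explicit bounds for the polar. *)
Definition cbody K := [/\ compact K, cvx K, forall x, K x -> K (- x) &
  exists2 e, 0 < e & box e `<=` K].

Lemma cbody0 K : cbody K -> K 0.
Proof. by case=> _ _ _ [e e0]; apply=> i; rewrite mxE normr0 ltW. Qed.

Lemma closed_pol K : closed (pol K).
Proof.
rewrite (_ : pol K = \bigcap_(x in K) [set y | `|dot x y| <= 1]); last first.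
  by apply/seteqP; split=> y py x; exact: py.
apply: closed_bigI => x _; apply: (@preimage_closed _ _ (fun y => `|dot x y|) [set t | t <= 1]).
  by move=> y _; exact: (cvg_norm (@dot_continuous x y)).
exact: closed_le.
Qed.

Lemma compact_box_bound K : compact K -> exists2 M, 0 < M & K `<=` box M.
Proof.
move=> /compact_bounded[M [_ /(_ (`|M| + 1))]] H.
have {}H := H (ltr_pwDr ltr01 (ler_norm M)).
exists (`|M| + 1) => [|x Kx i]; first by rewrite ltr_pwDr.
apply: le_trans (H x Kx).
rewrite [leRHS]/Num.norm /= mx_normrE; apply/bigmax_geP; right.
by exists (ord0, i).
Qed.

Lemma pol_box K e : 0 < e -> box e `<=` K -> pol K `<=` box e^-1.
Proof.
move=> e0 eK y py i; rewrite -(ler_pM2l e0) mulfV ?gt_eqF//.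
have /py : K (e *: delta_mx ord0 i).
  apply: eK => j; rewrite !mxE eqxx/= normrM (gtr0_norm e0).
  by case: (j == i); rewrite ?normr1 ?normr0 ?mulr1 ?mulr0// ltW.
rewrite dotZl /dot (bigD1 i)//= big1 ?addr0; last first.
  by move=> j ji; rewrite mxE (negbTE ji) andbF mul0r.
by rewrite mxE !eqxx mul1r normrM (gtr0_norm e0).
Qed.

Lemma box_pol K M : 0 < M -> K `<=` box M -> box (n.+1%:R * M)^-1 `<=` pol K.
Proof.
move=> M0 KM y yb x Kx; apply: le_trans (ler_norm_sum _ _ _) _.
apply: le_trans (_ : \sum_(i < n) n.+1%:R^-1 <= 1).
  apply: ler_sum => i _; rewrite normrM.
  apply: le_trans (ler_pM _ _ (KM _ Kx i) (yb i)) _ => //.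
  by rewrite invfM mulrCA mulfV ?mulr1 ?gt_eqF.
by rewrite sumr_const card_ord -[leLHS]mulr_natl ler_pdivrMr// mul1r ler_nat.
Qed.

Lemma cbody_pol K : cbody K -> cbody (pol K).
Proof.
move=> [cK _ sK [e e0 eK]]; split.
- by apply: (subclosed_compact _ (@box_compact R n e^-1)); [exact: closed_pol|exact: pol_box].
- move=> x y t /andP[t0 t1] px py z Kz; rewrite dotDr !dotZr.
  have t1' : 0 <= 1 - t by lra.
  apply: le_trans (ler_normD _ _) _; rewrite !normrM (ger0_norm t0) (ger0_norm t1').
  have a := px _ Kz; have b := py _ Kz.
  by have := ler_wpM2l t0 a; have := ler_wpM2l t1' b; lra.
- by move=> x px z Kz; rewrite dotNr normrN; exact: px.
- have [M M0 KM] := compact_box_bound cK.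
  by exists (n.+1%:R * M)^-1; [rewrite invr_gt0 mulr_gt0|exact: box_pol].
Qed.

Lemma cbodyI A B : cbody A -> cbody B -> cbody (A `&` B).
Proof.
move=> [cA vA sA [e e0 eA]] [cB vB sB [d d0 dB]]; split.
- have clW D : compact D -> closed D by apply: compact_closed; exact: norm_hausdorff.
  by apply: (subclosed_compact _ cA) => [|x []//]; apply: closedI; exact: clW.
- by move=> x y t t01 [Ax Bx] [Ay By]; split; [exact: vA|exact: vB].
- by move=> x [Ax Bx]; split; [exact: sA|exact: sB].
- exists (Num.min e d); first by rewrite lt_min e0.
  by move=> x xb; split; [apply: eA|apply: dB] => i; have := xb i; rewrite le_min => /andP[].
Qed.

(** The nearest point [p] of [C] to [z] gives a half-space that contains [C] and misses [z];
    symmetry of [C] turns the half-space into a slab. *)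
Lemma separation C z : compact C -> cvx C -> C 0 -> (forall c, C c -> C (- c)) -> ~ C z ->
  exists2 u, forall c, C c -> `|dot u c| <= 1 & 1 < dot u z.
Proof.
move=> cC vC C0 sC Cz.
have czc : continuous (fun c : W => z - c) by move=> c; exact: (cvgB (cvg_cst _) cvg_id).
have cf : {within C, continuous (fun c => dot (z - c) (z - c))}.
  by apply: continuous_subspaceT; exact: dot_continuous2.
have Cn : C !=set0 by exists 0.
have [p /[!inE] Cp pmin] := compact_EVT_min Cn cC cf.
pose u := z - p.
have u0 : 0 < dot u u.
  rewrite lt_neqAle dot_ge0 andbT eq_sym; apply/eqP => /dot0_eq0 /eqP.
  by rewrite subr_eq0 => /eqP zp; apply: Cz; rewrite zp.
have up c : C c -> dot u (c - p) <= 0.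
  move=> Cc; rewrite leNgt; apply/negP => b0.
  set b := dot u (c - p) in b0; set g := dot (c - p) (c - p).
  have g0 : 0 <= g by exact: dot_ge0.
  (* Moving from [p] towards [c] by [t] changes the squared distance to [z] by t^2 g - 2 t b, which
     is negative because t g < b. The denominator also keeps t at most 1. *)
  pose t := b / (b + g).
  have t0 : 0 < t by rewrite divr_gt0//; lra.
  have t1 : t <= 1 by rewrite ler_pdivrMr; lra.
  have Ct : C (t *: c + (1 - t) *: p) by apply: vC => //; rewrite (ltW t0) t1.
  have /mem_set/pmin := Ct.
  have -> : z - (t *: c + (1 - t) *: p) = u + (- t) *: (c - p).
    by apply/rowP => i; rewrite !mxE; ring.
  rewrite dot_sqrDZ -/u -/b -/g => H.
  have tbg : t * (b + g) = b by rewrite /t mulfVK ?gt_eqF//; lra.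
  have tp : 0 < t * b by rewrite mulr_gt0.
  have : t * (t * (b + g)) = t * b by rewrite tbg.
  have : 0 < t * (t * b) by rewrite mulr_gt0.
  by move: H tp; rewrite expr2; nra.
pose h := dot u p; pose d := dot u z.
have hd : h < d by rewrite -subr_gt0 /d /h -dotNr -dotDr.
have h0 : 0 <= h by have := up _ C0; rewrite sub0r dotNr; rewrite -/h; lra.
have hc c : C c -> dot u c <= h.
  by move=> /up; rewrite dotDr dotNr -/h; lra.
have hd0 : 0 < h + d by lra.
(* Normalizing by the midpoint of h < d puts 1 between the bound on [C] and the value at [z]; [h]
   itself may be 0. *)
exists ((2 / (h + d)) *: u) => [c Cc|]; rewrite dotZl.
  rewrite normrM ger0_norm ?divr_ge0 ?(ltW hd0)// mulrAC ler_pdivrMr// mul1r.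
  have := hc _ Cc; have := hc _ (sC _ Cc); rewrite dotNr => a1 a2.
  have : `|dot u c| <= h by rewrite ler_norml; lra.
  by lra.
by rewrite -/d mulrAC ltr_pdivlMr// mul1r; lra.
Qed.

Lemma bipolar K : cbody K -> pol (pol K) `<=` K.
Proof.
move=> bK z pz; apply: contrapT => Kz; have [cK vK sK _] := bK.
have [u uK uz] := separation cK vK (cbody0 bK) sK Kz.
have /pz : pol K u by move=> x Kx; rewrite dotC; exact: uK.
by rewrite leNgt (lt_le_trans uz (ler_norm _)).
Qed.

Lemma cvx_wcomb A a b s t : cvx A -> A a -> A b -> 0 <= s -> 0 <= t ->
  exists2 c, A c & s *: a + t *: b = (s + t) *: c.
Proof.
move=> vA Aa Ab s0 t0; have [st|st] := eqVneq (s + t) 0.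
  have /eqP := st; rewrite paddr_eq0// => /andP[/eqP -> /eqP ->].
  by exists a => //; rewrite !(addr0, scale0r).
have st0 : 0 < s + t by rewrite lt_neqAle eq_sym st addr_ge0.
exists ((s / (s + t)) *: a + (1 - s / (s + t)) *: b).
  by apply: vA => //; rewrite divr_ge0 ?(ltW st0)//= ler_pdivrMr// mul1r; lra.
by rewrite scalerDr !scalerA; congr (_ *: _ + _ *: _); field.
Qed.

Definition hull A B : set W := [set z | exists a b t,
  [/\ 0 <= t <= 1, A a, B b & z = t *: a + (1 - t) *: b]].

Lemma compact_hull A B : compact A -> compact B -> compact (hull A B).
Proof.
move=> cA cB; pose f (p : R * (W * W)) : W := p.1 *: p.2.1 + (1 - p.1) *: p.2.2.
have -> : hull A B = f @` (`[0, 1]%classic `*` (A `*` B)).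
  apply/seteqP; split=> [_ [a [b [t [t01 Aa Bb ->]]]]|_ [[t [a b]] [/= t01 [Aa Bb]] <-]].
    by exists (t, (a, b)) => //; split=> //=; rewrite in_itv.
  by exists a, b, t; split=> //; move: t01; rewrite in_itv.
apply: continuous_compact; last first.
  by apply: compact_setX; [exact: segment_compact|exact: compact_setX].
apply: continuous_subspaceT => p; rewrite /f.
have c1 : (fun p : R * (W * W) => p.1) q @[q --> p] --> p.1 by exact: cvg_fst.
have c2 : (fun p : R * (W * W) => p.2.1) q @[q --> p] --> p.2.1.
  by apply: (@continuous_comp _ _ _ snd fst p); [exact: cvg_snd|exact: cvg_fst].
have c3 : (fun p : R * (W * W) => p.2.2) q @[q --> p] --> p.2.2.
  by apply: (@continuous_comp _ _ _ snd snd p); exact: cvg_snd.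
exact: (cvgD (cvgZ c1 c2) (cvgZ (cvgB (cvg_cst _) c1) c3)).
Qed.

Lemma cvx_hull A B : cvx A -> cvx B -> cvx (hull A B).
Proof.
move=> vA vB _ _ s /andP[s0 s1] [a [b [t [/andP[t0 t1] Aa Bb ->]]]]
  [a' [b' [t' [/andP[t'0 t'1] Aa' Bb' ->]]]].
have s1' : 0 <= 1 - s by lra.
have [c Ac cE] := cvx_wcomb vA Aa Aa' (mulr_ge0 s0 t0) (mulr_ge0 s1' t'0).
have t1' : 0 <= 1 - t by lra. have t1'' : 0 <= 1 - t' by lra.
have [d Bd dE] := cvx_wcomb vB Bb Bb' (mulr_ge0 s0 t1') (mulr_ge0 s1' t1'').
exists c, d, (s * t + (1 - s) * t'); split=> //.
  have := mulr_ge0 s0 t0; have := mulr_ge0 s1' t'0.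
  by have := mulr_ge0 s0 t1'; have := mulr_ge0 s1' t1''; lra.
rewrite -cE (_ : 1 - (s * t + (1 - s) * t') = s * (1 - t) + (1 - s) * (1 - t')); last by ring.
by rewrite -dE !scalerDr !scalerA addrACA.
Qed.

(** A point outside the hull is separated from it by some [u]. Being bounded by 1 on both polars,
    [u] lies in [A] and in [B] by [bipolar], yet it pairs with the point to more than 1. *)
Lemma pol_setI A B : cbody A -> cbody B -> pol (A `&` B) `<=` hull (pol A) (pol B).
Proof.
move=> bA bB z pz; apply: contrapT => Hz.
have [pA pB] := (cbody_pol bA, cbody_pol bB).
have [cA vA sA _] := pA; have [cB vB sB _] := pB.
have [] := separation (compact_hull cA cB) (cvx_hull vA vB) _ _ Hz.
- by exists 0, 0, 0; rewrite !scaler0 addr0 lexx ler01; split=> //; exact: cbody0.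
- move=> _ [a [b [t [t01 Aa Bb ->]]]]; exists (- a), (- b), t.
  by split; [|exact: sA|exact: sB|rewrite !scalerN opprD].
move=> u uH uz.
have uA : A u.
  apply: bipolar => // x Ax; rewrite dotC; apply: uH.
  exists x, 0, 1; rewrite lexx ler01 scale1r scaler0 addr0; split=> //; exact: cbody0.
have uB : B u.
  apply: bipolar => // x Bx; rewrite dotC; apply: uH.
  exists 0, x, 0; rewrite lexx ler01 scaler0 subr0 add0r scale1r; split=> //; exact: cbody0.
by have := pz u (conj uA uB); rewrite leNgt (lt_le_trans uz (ler_norm _)).
Qed.

End Polarity.

(** * Ellipsoids along the coordinate axes and the volume product *)

Section Ellipsoids.
Variables (R : realType) (n : nat).
Local Notation W := 'rV[R]_n.
Implicit Types (x y z u a b d : W) (A B C K : set W).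

Definition ball1 : set W := [set x | dot x x <= 1].

(** For [pos_row a], the ellipsoid whose semi-axes are the entries of [a]. *)
Definition ell a : set W := dil (invr_row a) @^-1` ball1.

Lemma dot_le1 x y : ball1 x -> ball1 y -> `|dot x y| <= 1.
Proof.
rewrite /ball1/= => x1 y1; rewrite ler_norml.
have := dot_ge0 (x + 1 *: y); have := dot_ge0 (x + (-1) *: y).
by rewrite !dot_sqrDZ; lra.
Qed.

Lemma pol_ball1 : pol ball1 = ball1.
Proof.
apply/seteqP; split=> [y py|y y1 x x1]; last exact: dot_le1.
rewrite /ball1/= leNgt; apply/negP => N1.
pose s := Num.sqrt (dot y y).
have s1 : 1 < s by rewrite -(sqrtr1 R) ltr_sqrt//; lra.
have s0 : 0 < s by lra.
have sE : s ^+ 2 = dot y y by rewrite sqr_sqrtr// dot_ge0.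
have /py : ball1 (s^-1 *: y).
  by rewrite /ball1/= dotZl dotZr -sE expr2 mulKf ?gt_eqF// mulVf ?gt_eqF.
rewrite dotZl -sE expr2 mulKf ?gt_eqF// gtr0_norm//; lra.
Qed.

Lemma ball1_cbody : cbody ball1.
Proof.
have bb : ball1 `<=` box 1.
  move=> x x1 i; have := x1; rewrite /ball1/= /dot (bigD1 i)//=.
  have : 0 <= \sum_(j < n | j != i) x ord0 j * x ord0 j.
    by apply: sumr_ge0 => j _; rewrite -expr2 sqr_ge0.
  rewrite -expr2 -real_normK ?num_real// => s0 h.
  by rewrite -(@expr_le1 _ 2)//; lra.
split.
(* Closedness here and convexity below both come from [ball1] being its own polar. *)
- rewrite -pol_ball1; apply: (subclosed_compact _ (@box_compact R n 1)); first exact: closed_pol.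
  by rewrite pol_ball1.
- move=> x y t /andP[t0 t1] x1 y1; rewrite -pol_ball1 => z z1.
  rewrite dotDr !dotZr; have t1' : 0 <= 1 - t by lra.
  apply: le_trans (ler_normD _ _) _; rewrite !normrM (ger0_norm t0) (ger0_norm t1').
  have a := dot_le1 z1 x1; have b := dot_le1 z1 y1.
  by have := ler_wpM2l t0 a; have := ler_wpM2l t1' b; lra.
- by move=> x; rewrite /ball1/= dotNl dotNr opprK.
- exists (n.+1%:R^-1) => [|x xb]; first by rewrite invr_gt0.
  rewrite /ball1/=; apply: le_trans (_ : \sum_(i < n) n.+1%:R^-1 <= 1).
    apply: ler_sum => i _; rewrite -expr2 -real_normK ?num_real//.
    rewrite expr2; apply: le_trans (ler_pM _ _ (xb i) (xb i)) _ => //.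
    by rewrite ler_piMr// invf_le1// ler1n.
  by rewrite sumr_const card_ord -[leLHS]mulr_natl ler_pdivrMr// mul1r ler_nat.
Qed.

Lemma cbody_dil d K : pos_row d -> cbody K -> cbody (dil d @^-1` K).
Proof.
move=> d0 [cK vK sK [e e0 eK]]; split.
- exact: compact_dil.
- move=> x y t t01 /= Kx Ky.
  rewrite (_ : dil d _ = t *: dil d x + (1 - t) *: dil d y); first exact: vK.
  by apply/rowP => i; rewrite !mxE; ring.
- move=> x /= Kx; rewrite (_ : dil d _ = - dil d x); first exact: sK.
  by apply/rowP => i; rewrite !mxE mulrN.
- have [M M0 dM] : exists2 M, 0 < M & forall i, d ord0 i <= M.
    exists (1 + \sum_i d ord0 i) => [|i].
      by rewrite ltr_pwDl// sumr_ge0// => i _; exact: ltW.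
    rewrite (bigD1 i)//= addrCA lerDl addr_ge0// sumr_ge0// => j _; exact: ltW.
  exists (e / M) => [|x xb /=]; first by rewrite divr_gt0.
  apply: eK => i; rewrite mxE normrM gtr0_norm//.
  have := ler_pM (ltW (d0 i)) (normr_ge0 _) (dM i) (xb i).
  by rewrite mulrCA mulfV ?gt_eqF// mulr1.
Qed.

Lemma pol_dil d K : pos_row d -> pol (dil d @^-1` K) = dil (invr_row d) @^-1` pol K.
Proof.
move=> d0; apply/seteqP; split=> y py x Kx.
  rewrite /= -dot_dil; apply: py; rewrite /= dilVK//.
by have := py _ Kx; rewrite /= -dot_dil dilK.
Qed.

Lemma pol_sub A B : A `<=` B -> pol B `<=` pol A.
Proof. by move=> AB y py x Ax; apply: py; exact: AB. Qed.

Lemma ell_cbody a : pos_row a -> cbody (ell a).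
Proof. by move=> a0; apply: cbody_dil ball1_cbody; exact: pos_row_inv. Qed.

Lemma pol_ell a : pos_row a -> pol (ell a) = ell (invr_row a).
Proof. by move=> a0; rewrite /ell pol_dil ?pol_ball1//; exact: pos_row_inv. Qed.

Lemma ell1 : ell (const_mx 1) = ball1.
Proof.
rewrite /ell (_ : invr_row _ = const_mx 1); last by apply/rowP => i; rewrite !mxE invr1.
by apply/seteqP; split=> x /=; rewrite dil1.
Qed.

Lemma dil_ell d a : pos_row d -> dil d @^-1` ell a = ell (dil (invr_row d) a).
Proof.
move=> d0; rewrite /ell invr_row_dil invr_rowK.
by apply/seteqP; split=> x /=; rewrite dilA [dil d _]dilC.
Qed.

Lemma cbody_measurable K : cbody K -> measurable (K : set (rVb R n)).
Proof. by case=> cK _ _ _; exact: compact_rVb. Qed.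

Section Core.
Variable m : {measure set (rVb R n) -> \bar R}.
Hypothesis hm : haar m.

Local Notation v K := (fine (m K)).

Lemma vol_dil d K : pos_row d -> cbody K -> v (dil d @^-1` K) = psi m d * v K.
Proof.
move=> d0 bK; rewrite psiE//; last exact: cbody_measurable.
by rewrite fineM//; apply: haar_fin => //; case: bK.
Qed.

Lemma vol_le A B : cbody A -> cbody B -> A `<=` B -> v A <= v B.
Proof.
move=> bA bB AB; apply: fine_le.
- by apply: haar_fin => //; case: bA.
- by apply: haar_fin => //; case: bB.
- by apply: le_measure => //; rewrite inE; exact: cbody_measurable.
Qed.

Lemma vol_gt0 A : cbody A -> 0 < v A.
Proof.
move=> bA; have [cA _ _ [e e0 eA]] := bA.
apply: lt_le_trans (fine_haar_box_gt0 hm e0) _.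
apply: fine_le => //; try by apply: haar_fin => //; exact: box_compact.
apply: le_measure => //; rewrite inE; last exact: cbody_measurable.
exact: measurable_box.
Qed.

Definition mahler K := v K * v (pol K).

Lemma mahler_dil d K : pos_row d -> cbody K -> mahler (dil d @^-1` K) = mahler K.
Proof.
move=> d0 bK; rewrite /mahler pol_dil// vol_dil// vol_dil//; last 2 first.
- exact: pos_row_inv.
- exact: cbody_pol.
by rewrite psiV// mulrACA mulfV ?mul1r// gt_eqF// psi_gt0.
Qed.

Lemma vol_ell a : pos_row a -> v (ell a) = (psi m a)^-1 * v ball1.
Proof.
move=> a0; rewrite /ell vol_dil//; last exact: ball1_cbody.
  by rewrite psiV.
exact: pos_row_inv.
Qed.

Lemma mahler_ell a : pos_row a -> mahler (ell a) = v ball1 ^+ 2.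
Proof.
move=> a0; rewrite /ell mahler_dil//; last exact: ball1_cbody.
  by rewrite /mahler pol_ball1.
exact: pos_row_inv.
Qed.

Lemma mahler_setI K : cbody K -> mahler (K `&` pol K) <= 2 ^+ n * mahler K.
Proof.
move=> bK; have bp := cbody_pol bK; have bL := cbodyI bK bp; have bpL := cbody_pol bL.
have fin A : cbody A -> m A \is a fin_num by case=> cA _ _ _; exact: haar_fin.
rewrite /mahler [v (K `&` _) * _]mulrC [v K * _]mulrC.
(* The two remaining sets are read off the goal: [L] is [K] intersected with its polar, and [C] is
   the polar of [L]. *)
apply: (rogers_shephard hm (A := pol K) (B := K)); try exact: cbody_measurable.
- exact: fin. - exact: fin. - exact: fin. - exact: fin.
- by case: bp. - by case: bK. - exact: cbody0. - exact: cbody0.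
- by move=> w [].
- by move=> w [Kw _]; case: bK => _ _ + _; apply.
- move=> z /(pol_setI bK bp) [a [b [t [t01 pa ppb ->]]]].
  by exists a, b, t; split=> //; exact: bipolar.
Qed.

(** The logarithm is concave and the two sides agree at 2 and at 4. *)
Lemma le_2log2 (r : R) : 2 <= r <= 4 -> r <= 2 * log2 r.
Proof.
move=> /andP[r2 r4]; rewrite /log2.
have l2 : 0 < ln 2 :> R by rewrite ln_gt0// ltr1n.
pose t := (4 - r) / 2.
have t01 : 0 <= t <= 1 by rewrite /t; apply/andP; split; lra.
have := @concave_ln R (Itv01 (proj1 (andP t01)) (proj2 (andP t01))) 2 4 ltac:(lra) ltac:(lra).
rewrite !convRE /= /unstable.onem => H.
have rE : t * 2 + (1 - t) * 4 = r by rewrite /t; lra.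
rewrite rE in H.
have l4 : ln 4 = 2 * ln 2 :> R.
  by rewrite (_ : 4 = 2 * 2)// ?lnM ?posrE//; lra.
rewrite mulrA ler_pdivlMr//; apply: le_trans (ler_wpM2l _ H); last by [].
rewrite l4 /t.
suff : r * ln 2 <= 2 * ((4 - r) / 2 * ln 2 + (1 - (4 - r) / 2) * (2 * ln 2)) by [].
have -> : 2 * ((4 - r) / 2 * ln 2 + (1 - (4 - r) / 2) * (2 * ln 2)) = r * ln 2 by field.
exact: lexx.
Qed.

(** The polar of [K] contains that of [ell b], whose volume is [psi m b] times that of [ball1].
    Hence the loss is at most the ratio r^n of the two ellipsoids. *)
Lemma mahler_ge_base (r : R) a b K : 2 <= r <= 4 ->
  pos_row a -> pos_row b -> cbody K -> ell a `<=` K -> K `<=` ell b ->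
  v (ell b) = r ^+ n * v (ell a) -> (2 * log2 r) ^- n * v ball1 ^+ 2 <= mahler K.
Proof.
move=> r24 a0 b0 bK aK Kb; have rl := le_2log2 r24; have /andP[r2 r4] := r24.
have r0 : 0 < r by lra. have l0 : 0 < 2 * log2 r by lra.
have ba := ell_cbody a0; have bb := ell_cbody b0.
have v1 := vol_gt0 ball1_cbody; have pa := psi_gt0 hm a0; have pb := psi_gt0 hm b0.
rewrite !vol_ell// mulrA => /(mulIf (lt0r_neq0 v1)) ab.
apply: le_trans (_ : v (ell a) * v (pol (ell b)) <= _); last first.
  apply: ler_pM; rewrite ?fine_ge0//; apply: vol_le => //; try exact: cbody_pol.
  exact: pol_sub.
rewrite pol_ell// vol_ell// vol_ell; last exact: pos_row_inv.
rewrite psiV// invrK mulrACA -expr2 ler_wpM2r ?exprn_ge0 ?(ltW v1)//.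
have -> : (psi m a)^-1 * psi m b = r ^- n.
  apply: (mulIf (lt0r_neq0 (exprn_gt0 n r0))); rewrite mulVf ?gt_eqF ?exprn_gt0//.
  by rewrite mulrAC [_ * r ^+ n]mulrC -ab mulVf ?gt_eqF.
rewrite lef_pV2 ?posrE ?exprn_gt0//.
by apply: lerXn2r => //; rewrite nnegrE ltW.
Qed.

(* After rescaling by the geometric mean of a and b, the outer ellipsoid is the
   polar of the inner one ell a', so that ell a' <= K & pol K <= ball1. *)
Lemma mahler_ge (k : nat) (r : R) a b K : 2 <= r -> r <= 4 ^+ (2 ^ k)%N ->
  pos_row a -> pos_row b -> cbody K -> ell a `<=` K -> K `<=` ell b ->
  v (ell b) = r ^+ n * v (ell a) -> (2 * log2 r) ^- n * v ball1 ^+ 2 <= mahler K.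
Proof.
elim: k r a b K => [|k IH] r a b K r2 rk a0 b0 bK aK Kb.
  by apply: mahler_ge_base => //; rewrite r2.
(* The index [k] bounds the number of square roots still to be taken. The recursion also stops as
   soon as r <= 4, since beyond that sqrt r could drop below 2. *)
have [r4|r4] := lerP r 4; first by apply: mahler_ge_base => //; rewrite r2.
have r0 : 0 < r by lra.
have v1 := vol_gt0 ball1_cbody; have pa := psi_gt0 hm a0; have pb := psi_gt0 hm b0.
rewrite !vol_ell// mulrA => /(mulIf (lt0r_neq0 v1)) ab.
pose s := Num.sqrt r.
have s0' : 0 <= s by exact: sqrtr_ge0.
have sE : s ^+ 2 = r by rewrite sqr_sqrtr// ltW.
have s2 : 2 <= s by rewrite -(@ler_pXn2r _ 2) ?nnegrE// sE; lra.
have s0 : 0 < s by lra.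
pose d : W := \row_i Num.sqrt (a ord0 i * b ord0 i).
have d0 : pos_row d by move=> i; rewrite mxE sqrtr_gt0 mulr_gt0.
pose K' := dil d @^-1` K.
have bK' : cbody K' by exact: cbody_dil.
pose a' := dil (invr_row d) a.
have a'0 : pos_row a' by apply: pos_row_dil => //; exact: pos_row_inv.
(* Entrywise d^2 = a b, so b / d = d / a. *)
have b'E : dil (invr_row d) b = invr_row a'.
  apply/rowP => i; rewrite !mxE.
  set x := a ord0 i; set y := b ord0 i.
  have x0 : 0 < x by exact: a0. have y0 : 0 < y by exact: b0.
  set e := Num.sqrt _.
  have e0 : 0 < e by rewrite sqrtr_gt0 mulr_gt0.
  have eE : e ^+ 2 = x * y by rewrite sqr_sqrtr// ltW// mulr_gt0.
  have -> : y = e ^+ 2 / x by rewrite eE mulrAC mulfV ?mul1r ?gt_eqF.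
  by field; rewrite !gt_eqF.
have aK' : ell a' `<=` K' by rewrite -dil_ell// => x /aK.
have Kb' : K' `<=` ell (invr_row a') by rewrite -b'E -dil_ell// => x /Kb.
rewrite -(mahler_dil d0 bK) -/K'.
pose L := K' `&` pol K'.
have bL : cbody L by apply: cbodyI => //; exact: cbody_pol.
have aL : ell a' `<=` L.
  move=> x ax; split; first exact: aK'.
  by have := pol_sub Kb'; rewrite pol_ell ?invr_rowK; [apply|exact: pos_row_inv].
(* A point of both [K'] and its polar may be paired with itself. *)
have Lb : L `<=` ell (const_mx 1).
  rewrite ell1 => x [Kx px]; have := px _ Kx; rewrite ger0_norm//; exact: dot_ge0.
have pa' := psi_gt0 hm a'0.
(* Squares are compared. With b' = b / d = 1 / a', multiplicativity of [psi] gives psi(a')^2 =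
   psi(a') / psi(b') = psi(a) / psi(b) = r^n. *)
have sp : psi m a' = s ^+ n.
  have : psi m (dil (invr_row d) b) = (psi m a')^-1 by rewrite b'E psiV.
  have di := pos_row_inv d0.
  have pd := psi_gt0 hm d0.
  move: pa'; rewrite /a' !psiM// psiV// => pa' bE.
  apply/eqP; rewrite -(@eqrXn2 _ 2) ?(ltW pa') ?exprn_ge0//.
  rewrite -exprM mulnC exprM sE; apply/eqP.
  have -> : r ^+ n = psi m a / psi m b.
    by rewrite mulrC ab mulfVK// gt_eqF.
  have -> : psi m b = psi m d * ((psi m d)^-1 * psi m a)^-1.
    by rewrite -bE mulrA mulfV ?mul1r// gt_eqF.
  by field; rewrite !gt_eqF.
have p1 : pos_row (const_mx 1 : W) by exact: pos_row_const.
have s4 : s <= 4 ^+ (2 ^ k)%N.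
  by rewrite -(@ler_pXn2r _ 2) ?nnegrE ?exprn_ge0// sE -exprM -expnSr.
have volE : v (ell (const_mx 1)) = s ^+ n * v (ell a').
  by rewrite ell1 vol_ell// sp mulrA mulfV ?mul1r// gt_eqF// exprn_gt0.
have H := IH s a' (const_mx 1) L s2 s4 a'0 p1 bL aL Lb volE.
have {}H := le_trans H (mahler_setI bK').
have ls : 2 * log2 s = log2 r by rewrite /log2 mulrA mulr_natl -lnXn// sE.
have lr : 0 < log2 r by rewrite -ls mulr_gt0// /log2 divr_gt0 ?ln_gt0 ?ltr1n//; lra.
rewrite ls in H.
by rewrite exprMn invfM -mulrA ler_pdivrMl ?exprn_gt0.
Qed.

End Core.
End Ellipsoids.

(** * Simultaneous diagonalization and coordinates *)

Definition inner (R : realType) (V : lmodType R) (g : V -> V -> R) :=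
  [/\ forall x y, g x y = g y x, forall x y z, g (x + y) z = g x z + g y z,
      forall a x y, g (a *: x) y = a * g x y & forall x, x != 0 -> 0 < g x x].

Lemma inner_dot (R : realType) (V : vectType R) (g : {dot V for idfun}) : inner g.
Proof.
split.
- by move=> x y; rewrite hermC expr0 mul1r.
- by move=> x y z; rewrite linearDl.
- by move=> a x y; rewrite linearZl_LR.
- by move=> x; exact: neq0_dnorm_gt0.
Qed.

Section Inner.
Variables (R : realType) (V : lmodType R) (g : V -> V -> R).
Hypothesis ig : inner g.

Lemma innerC x y : g x y = g y x. Proof. by case: ig. Qed.
Lemma innerDl x y z : g (x + y) z = g x z + g y z. Proof. by case: ig. Qed.
Lemma innerZl a x y : g (a *: x) y = a * g x y. Proof. by case: ig. Qed.
Lemma inner_gt0 x : x != 0 -> 0 < g x x. Proof. by case: ig => _ _ _; apply. Qed.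
Lemma innerDr x y z : g x (y + z) = g x y + g x z.
Proof. by rewrite innerC innerDl !(innerC x). Qed.
Lemma innerZr a x y : g x (a *: y) = a * g x y.
Proof. by rewrite innerC innerZl innerC. Qed.
Lemma inner0l x : g 0 x = 0.
Proof. by rewrite -(scale0r x) innerZl mul0r. Qed.
Lemma innerNr x y : g x (- y) = - g x y.
Proof. by rewrite -scaleN1r innerZr mulN1r. Qed.
Lemma inner_suml (I : finType) (f : I -> V) x : g (\sum_i f i) x = \sum_i g (f i) x.
Proof.
elim/big_ind2 : _ => [|y s z t <- <-|//]; first exact: inner0l.
by rewrite innerDl.
Qed.
Lemma inner_sumr (I : finType) (f : I -> V) x : g x (\sum_i f i) = \sum_i g x (f i).
Proof. by rewrite innerC inner_suml; apply: eq_bigr => i _; rewrite innerC. Qed.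

Lemma inner_sqrD t x y : g (x + t *: y) (x + t *: y) = g x x + 2 * t * g x y + t ^+ 2 * g y y.
Proof. by rewrite !(innerDl, innerDr, innerZl, innerZr) (innerC y x); ring. Qed.
End Inner.

(** At t = - s with s = B / (C + 1), the expression equals - s^2 (C + 2), which forces s = 0; C + 1
    is used because C may vanish. *)
Lemma quadratic_ge0_lin0 (R : realFieldType) (B C : R) : 0 <= C ->
  (forall t, 0 <= 2 * t * B + t ^+ 2 * C) -> B = 0.
Proof.
move=> C0 H; have C1 : 0 < C + 1 by lra.
have := H (- (B / (C + 1))); pose s := B / (C + 1).
have Bs : B = s * (C + 1) by rewrite /s divfK// gt_eqF.
rewrite -/s => Hs.
have : s ^+ 2 * (C + 2) <= 0 by rewrite expr2 in Hs *; rewrite Bs in Hs; lra.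
rewrite pmulr_lle0; last by lra.
move=> s2; have : s ^+ 2 == 0 by rewrite eq_le s2 sqr_ge0.
by rewrite sqrf_eq0 => /eqP s0; rewrite Bs s0 mul0r.
Qed.

Section Diagonalization.
Variables (R : realType) (V : vectType R) (g1 g2 : V -> V -> R).
Hypotheses (i1 : inner g1) (i2 : inner g2).
Local Notation n := (\dim {:V}).
Local Notation W := 'rV[R]_n.
Local Notation coo := (passmx.rVof (vbasis {:V})).
Local Notation vec := (passmx.vecof (vbasis {:V})).

Let vb : basis_of {:V} (vbasis {:V}). Proof. exact: vbasisP. Qed.

Lemma vecZ a w : vec (a *: w) = a *: vec w.
Proof. by rewrite /passmx.vecof scaler_sumr; apply: eq_bigr => i _; rewrite mxE scalerA. Qed.

Lemma inner_vec_continuous (g : V -> V -> R) (x : V) : inner g ->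
  continuous (fun w : W => g x (vec w)).
Proof.
move=> ig.
rewrite (_ : (fun _ => _) = (fun w : W => \sum_i w ord0 i * g x (vbasis {:V})`_i)).
  apply: continuous_sum => i w.
  exact: (cvgM (@coord_continuous _ _ _ _ _ w) (cvg_cst _)).
apply/funext => w; rewrite /passmx.vecof (inner_sumr ig).
by apply: eq_bigr => i _; rewrite (innerZr ig).
Qed.

Lemma inner_vec2_continuous (g : V -> V -> R) : inner g ->
  continuous (fun w : W => g (vec w) (vec w)).
Proof.
move=> ig.
rewrite (_ : (fun _ => _) = (fun w : W => \sum_i w ord0 i * g (vbasis {:V})`_i (vec w))).
  apply: continuous_sum => i w.
  exact: (cvgM (@coord_continuous _ _ _ _ _ w) (@inner_vec_continuous g _ ig w)).
apply/funext => w; rewrite {1}/passmx.vecof (inner_suml ig).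
by apply: eq_bigr => i _; rewrite (innerZl ig).
Qed.

Definition orthonormal_fam k (e : 'I_k -> V) :=
  forall i j, g1 (e i) (e j) = (i == j)%:R.

Lemma fourier_coef k (e : 'I_k -> V) y i : orthonormal_fam e ->
  g1 (e i) (\sum_j g1 (e j) y *: e j) = g1 (e i) y.
Proof.
move=> oe; rewrite (inner_sumr i1) (bigD1 i)//= (innerZr i1) oe eqxx mulr1 big1 ?addr0//.
by move=> j ji; rewrite (innerZr i1) oe eq_sym (negbTE ji) mulr0.
Qed.

Lemma orthonormal_extend k (e : 'I_k -> V) : (k < n)%N -> orthonormal_fam e ->
  exists2 x, x != 0 & forall i, g1 (e i) x = 0.
Proof.
move=> kn oe; pose U := <<[seq e i | i : 'I_k]>>%VS.
have [x xU] : exists x, x \notin U.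
  apply: contrapT => H; suff /dimvS : ({:V} <= U)%VS.
    rewrite leqNgt => /negP; apply; apply: leq_ltn_trans kn.
    by apply: leq_trans (dim_span _) _; rewrite size_map size_enum_ord.
  by apply/subvP => x _; apply: contrapT => /negP xU; apply: H; exists x.
exists (x - \sum_j g1 (e j) x *: e j).
  apply: contra xU; rewrite subr_eq0 => /eqP ->.
  apply: memv_suml => j _; apply: memvZ; apply: memv_span.
  by apply/mapP; exists j => //; rewrite mem_enum.
by move=> i; rewrite (innerDr i1) (innerNr i1) fourier_coef// subrr.
Qed.

(** Each [e i] is an eigenvector of [g2] relative to [g1]. Testing against every y, and not only
    against the family, makes a later vector that is [g1]-orthogonal to [e i] also [g2]-orthogonal
    to it. *)
Definition diag_fam k (e : 'I_k -> V) :=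
  forall i y, g2 (e i) y = g2 (e i) (e i) * g1 (e i) y.

Lemma rayleigh_max k (e : 'I_k -> V) : (k < n)%N -> orthonormal_fam e ->
  exists x M, [/\ x != 0, forall i, g1 (e i) x = 0, g2 x x = M * g1 x x &
    forall y, (forall i, g1 (e i) y = 0) -> g2 y y <= M * g1 y y].
Proof.
move=> kn oe; have [x0 x00 ex0] := orthonormal_extend kn oe.
pose nrm (y : V) : W := `|coo y|^-1 *: coo y.
pose S : set W := [set w | `|w| = 1] `&` \bigcap_i [set w | g1 (e i) (vec w) = 0].
have nrmS y : y != 0 -> (forall i, g1 (e i) y = 0) -> S (nrm y).
  move=> y0 ey; have c0 : `|coo y| != 0 by rewrite normr_eq0 passmx.rVof_eq0.
  split=> /=; first by rewrite /nrm normrZ normfV normr_id mulVf.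
  by move=> i _ /=; rewrite /nrm vecZ passmx.rVofK// (innerZr i1) ey mulr0.
have cS : compact S.
  apply: bounded_closed_compact.
    by exists 1; split=> // M M1 w [/= -> _]; exact: ltW.
  apply: closedI.
    apply: (@preimage_closed _ _ (fun w : W => `|w|) [set 1]); last exact: closed_eq.
    by move=> w _; exact: norm_continuous.
  apply: closed_bigI => i _.
  apply: (@preimage_closed _ _ (fun w : W => g1 (e i) (vec w)) [set 0]); last exact: closed_eq.
  by move=> w _; exact: inner_vec_continuous.
have S0 w : S w -> vec w != 0.
  move=> [/= w1 _]; rewrite passmx.vecof_eq0//; apply/eqP => w0.
  by move: w1; rewrite w0 normr0 => /eqP; rewrite eq_sym oner_eq0.
pose f (w : W) := g2 (vec w) (vec w) / g1 (vec w) (vec w).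
have cf : {within S, continuous f}.
  apply: continuous_in_subspaceT => w; rewrite inE => Sw.
  have g1w : g1 (vec w) (vec w) != 0 by rewrite gt_eqF// inner_gt0// S0.
  exact: (cvgM (@inner_vec2_continuous g2 i2 w) (cvgV g1w (@inner_vec2_continuous g1 i1 w))).
have Sn : S !=set0 by exists (nrm x0); exact: nrmS.
have [w /[!inE] Sw wmax] := compact_EVT_max Sn cS cf.
exists (vec w), (f w); split.
- exact: S0.
- by move=> i; case: Sw => _ /(_ i I).
- by rewrite /f divfK// gt_eqF// inner_gt0// S0.
move=> y ey; have [->|y0] := eqVneq y 0; first by rewrite (inner0l i2) (inner0l i1) mulr0.
have /mem_set/wmax := nrmS y y0 ey.
have c0 : `|coo y| != 0 by rewrite normr_eq0 passmx.rVof_eq0.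
rewrite {1}/f /nrm vecZ passmx.rVofK// !(innerZr i1, innerZr i2, innerZl i1, innerZl i2).
rewrite -mulf_div mulfV ?invr_eq0// mul1r -mulf_div mulfV ?invr_eq0// mul1r.
by rewrite ler_pdivrMr// inner_gt0.
Qed.

(** On the complement of the family, M g1 - g2 is nonnegative and vanishes at the maximizer x, so
    its first variation at x vanishes there. For a general y, the components along the [e j]
    contribute nothing, because both forms vanish on x and [e j]. *)
Lemma diag_step k (e : 'I_k -> V) : (k < n)%N -> orthonormal_fam e -> diag_fam e ->
  exists x, [/\ g1 x x = 1, forall i, g1 (e i) x = 0 & forall y, g2 x y = g2 x x * g1 x y].
Proof.
move=> kn oe de; have [x [M [x0 ex xM yM]]] := rayleigh_max kn oe.
pose h u v := M * g1 u v - g2 u v.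
have hS y : (forall i, g1 (e i) y = 0) -> h x y = 0.
  move=> ey; apply: (@quadratic_ge0_lin0 _ _ (h y y)) => [|t].
    by rewrite subr_ge0; exact: yM.
  have /yM : forall i, g1 (e i) (x + t *: y) = 0.
    by move=> i; rewrite (innerDr i1) (innerZr i1) ex ey mulr0 addr0.
  by rewrite (inner_sqrD i1) (inner_sqrD i2) xM /h; lra.
have hx y : g2 x y = M * g1 x y.
  pose y' := y - \sum_j g1 (e j) y *: e j.
  have /hS/eqP : forall i, g1 (e i) y' = 0.
    by move=> i; rewrite (innerDr i1) (innerNr i1) fourier_coef// subrr.
  rewrite /h subr_eq0 /y' !(innerDr i1, innerDr i2, innerNr i1, innerNr i2).
  rewrite (inner_sumr i1) (inner_sumr i2) !big1 ?subr0; first by move=> /eqP.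
  - by move=> j _; rewrite (innerZr i2) (innerC i2 x) de ex !mulr0.
  - by move=> j _; rewrite (innerZr i1) (innerC i1 x) ex mulr0.
have x1 := inner_gt0 i1 x0.
pose s := (Num.sqrt (g1 x x))^-1.
have s2 : s * (s * g1 x x) = 1.
  by rewrite mulrA /s -invfM -expr2 sqr_sqrtr ?ltW// mulVf// gt_eqF.
exists (s *: x); split=> [|i|y].
- by rewrite (innerZl i1) (innerZr i1).
- by rewrite (innerZr i1) ex mulr0.
- rewrite !(innerZr i1, innerZr i2, innerZl i1, innerZl i2) !hx.
  by transitivity (s * (s * g1 x x) * (M * (s * g1 x y))); [rewrite s2; ring|ring].
Qed.

Lemma simultaneous_diag : exists e : 'I_n -> V, orthonormal_fam e /\ diag_fam e.
Proof.
suff H k : (k <= n)%N -> exists e : 'I_k -> V, orthonormal_fam e /\ diag_fam e by exact: H.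
elim: k => [_|k IH kn]; first by exists (fun _ => 0); split; case.
have [e [oe de]] := IH (ltnW kn).
have [x [x1 ex dx]] := diag_step kn oe de.
exists (fun i => if unlift ord0 i is Some j then e j else x); split.
  move=> i j; case: (unliftP ord0 i) => [i' ->|->]; case: (unliftP ord0 j) => [j' ->|->].
  - by rewrite oe (inj_eq lift_inj).
  - by rewrite ex.
  - by rewrite (innerC i1) ex.
  - by rewrite x1 eqxx.
by move=> i y; case: (unliftP ord0 i) => [i' _|_]; [exact: de|exact: dx].
Qed.

Lemma orthonormal_decomp (e : 'I_n -> V) : orthonormal_fam e ->
  forall x, x = \sum_i g1 (e i) x *: e i.
Proof.
move=> oe x; pose b := [tuple e i | i < n].
have bE (i : 'I_n) : b`_i = e i by rewrite -tnth_nth tnth_mktuple.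
have bb : basis_of {:V} b.
  rewrite basisEfree subvf size_tuple leqnn !andbT; apply/freeP => c c0 i.
  have := congr1 (g1 (e i)) c0; rewrite (innerC i1 _ 0) (inner0l i1) => <-.
  rewrite (inner_sumr i1) (bigD1 i)//= bE (innerZr i1) oe eqxx mulr1 big1 ?addr0//.
  by move=> j ji; rewrite bE (innerZr i1) oe eq_sym (negbTE ji) mulr0.
have xE := coord_basis bb (memvf x).
rewrite {1}xE; apply: eq_bigr => i _; rewrite bE; congr (_ *: _).
rewrite [in RHS]xE (inner_sumr i1) (bigD1 i)//= bE (innerZr i1) oe eqxx mulr1 big1 ?addr0//.
by move=> j ji; rewrite bE (innerZr i1) oe eq_sym (negbTE ji) mulr0.
Qed.

End Diagonalization.

(** * Transport of topology and volume to row vectors along a linear bijection *)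

Section Transport.
Variable R : realType.

Lemma linear_sumf (U V : lmodType R) (f : U -> V) (I : finType) (c : I -> R) (u : I -> U) :
  linear f -> f (\sum_i c i *: u i) = \sum_i c i *: f (u i).
Proof.
move=> lf; have f0 : f 0 = 0.
  by have := lf (-1) 0 0; rewrite scaler0 addr0 scaleN1r addNr.
by elim/big_rec2 : _ => // i y x _ <-; rewrite lf.
Qed.

Lemma linear_rV_continuous (p q : nat) (f : 'rV[R]_p -> 'rV[R]_q) : linear f -> continuous f.
Proof.
move=> lf; apply: continuous_rV => j.
rewrite (_ : (fun _ => _) = (fun w : 'rV[R]_p => \sum_i w ord0 i * f (delta_mx 0 i) ord0 j)).
  apply: continuous_sum => i w.
  exact: (cvgM (@coord_continuous _ _ _ _ _ w) (cvg_cst _)).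
apply/funext => w; rewrite {1}(row_sum_delta w) linear_sumf// summxE.
by apply: eq_bigr => i _; rewrite mxE.
Qed.

Variables (V : vectType R) (n : nat) (Phi : V -> 'rV[R]_n) (Psi : 'rV[R]_n -> V).
Hypotheses (lPhi : linear Phi) (PhiK : cancel Phi Psi) (PsiK : cancel Psi Phi).

Lemma linear_cancel : linear Psi.
Proof. by move=> a x y; rewrite -{1}(PsiK x) -{1}(PsiK y) -lPhi PhiK. Qed.

Local Notation coo := (passmx.rVof (vbasis {:V})).
Local Notation vec := (passmx.vecof (vbasis {:V})).

(** The topology of V is pulled back along one fixed basis; any other linear chart differs from that
    one by a linear map of rows. *)
Lemma Phi_continuous : continuous (Phi : vtop V -> 'rV[R]_n).
Proof.
have -> : (Phi : vtop V -> 'rV[R]_n) = (Phi \o vec) \o (coo : vtop V -> _).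
  by apply/funext => x /=; rewrite passmx.rVofK// vbasisP.
move=> x; apply: (@continuous_comp (vtop V)); first exact: initial_continuous.
apply: linear_rV_continuous => a u w /=.
have -> : vec (a *: u + w) = a *: vec u + vec w by exact: passmx.vecof_linear.
exact: lPhi.
Qed.

Lemma Psi_continuous : continuous (Psi : 'rV[R]_n -> vtop V).
Proof.
have /continuousP cf : continuous (coo \o Psi).
  by apply: linear_rV_continuous => a u w /=; rewrite linear_cancel; exact: passmx.rVof_linear.
by apply/continuousP => _ [U oU <-]; exact: (cf U oU).
Qed.

Lemma preimage_Psi (A : set V) : Psi @^-1` A = Phi @` A.
Proof.
apply/seteqP; split=> [w Aw|_ [x Ax <-]] /=; last by rewrite PhiK.
by exists (Psi w).
Qed.

Lemma preimage_Phi (A : set 'rV[R]_n) : Phi @^-1` A = Psi @` A.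
Proof.
apply/seteqP; split=> [w Aw|_ [x Ax <-]] /=; last by rewrite PsiK.
by exists (Phi w).
Qed.

Lemma compact_Psi (A : set V) : compact (A : set (vtop V)) -> compact (Psi @^-1` A).
Proof.
move=> cA; rewrite preimage_Psi; apply: (@continuous_compact (vtop V)) cA.
by apply: continuous_subspaceT; exact: Phi_continuous.
Qed.

Lemma compact_Phi (A : set 'rV[R]_n) : compact A -> compact (Phi @^-1` A : set (vtop V)).
Proof.
move=> cA; rewrite preimage_Phi; apply: (@continuous_compact _ (vtop V)) cA.
by apply: continuous_subspaceT; exact: Psi_continuous.
Qed.

Lemma measurable_Phi : measurable_fun setT (Phi : borel V -> rVb R n).
Proof.
apply: (@measurability _ _ (borel V) (rVb R n) setT Phi (@open 'rV[R]_n)) => //.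
move=> _ [U oU <-]; rewrite setTI; apply: sub_sigma_algebra.
by have /continuousP := Phi_continuous; apply.
Qed.

Lemma volume_element_haar (mu : {measure set (borel V) -> \bar R}) : volume_element mu ->
  exists m : {measure set (rVb R n) -> \bar R},
    haar m /\ forall A, m (Psi @^-1` A) = mu A.
Proof.
move=> [ht hc h0]; have mP := measurable_Phi.
pose m : {measure set (rVb R n) -> \bar R} := pushforward mu (Phi : borel V -> rVb R n).
have PhiD x y : Phi (x + y) = Phi x + Phi y.
  by have := lPhi 1 x y; rewrite !scale1r.
exists (m mP); split; last first.
  move=> A; rewrite /m /= /pushforward; congr (mu _).
  by apply/seteqP; split=> x /=; rewrite PhiK.
split.
- move=> A v mA; rewrite /m /= /pushforward.
  rewrite -(ht (Phi @^-1` A) (Psi v)); last first.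
    by rewrite -[X in measurable X]setTI; exact: mP.
  congr (mu _); apply/seteqP; split=> [x /= [w Aw wx]|_ [x Ax <-]] /=.
    exists (Psi w); first by rewrite /= PsiK.
    by apply: (can_inj PhiK); rewrite PhiD !PsiK.
  by exists (Phi x) => //; rewrite PhiD PsiK.
- by move=> K cK; exact: (hc (Phi @^-1` K) (compact_Phi cK)).
- exact: h0.
Qed.

End Transport.

(** V is charted by a [g1]-orthonormal basis that diagonalizes [g2], and V^* by evaluation on the
    same basis, so that the pairing becomes [dot] and [polar] becomes [pol]. Both volumes then are
    translation-invariant measures on the same rows, and [c] is their ratio. *)
Lemma ellipsoid_coordinates (R : realType) (V : vectType R)
    (mu : {measure set (borel V) -> \bar R})
    (nu : {measure set (borel (dualv V)) -> \bar R}) (g1 g2 : V -> V -> R) :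
  inner g1 -> inner g2 -> volume_element mu -> volume_element nu ->
  exists (Psi : 'rV[R]_(\dim {:V}) -> V) (m : {measure set (rVb R (\dim {:V})) -> \bar R})
      (b : 'rV[R]_(\dim {:V})) (c : R),
    [/\ haar m, 0 < c, pos_row b, linear Psi &
    [/\ Psi @^-1` [set x | g1 x x <= 1] = ell (const_mx 1),
        Psi @^-1` [set x | g2 x x <= 1] = ell b,
        forall A, compact (A : set (vtop V)) -> compact (Psi @^-1` A),
        forall A, mu A = m (Psi @^-1` A) &
        forall A, cbody (Psi @^-1` A) ->
          vol nu (polar A) = c * fine (m (pol (Psi @^-1` A)))]].
Proof.
move=> i1 i2 hmu hnu; set n := \dim _.
have [e [oe de]] := simultaneous_diag i1 i2.
have dec := orthonormal_decomp i1 oe.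
pose Phi (x : V) : 'rV[R]_n := \row_i g1 (e i) x.
pose Psi (w : 'rV[R]_n) : V := \sum_i w ord0 i *: e i.
have lPhi : linear Phi.
  by move=> a x y; apply/rowP => i; rewrite !mxE (innerDr i1) (innerZr i1).
have PhiK : cancel Phi Psi.
  by move=> x; rewrite [RHS]dec; apply: eq_bigr => i _; rewrite mxE.
have g1Psi w i : g1 (e i) (Psi w) = w ord0 i.
  rewrite /Psi (inner_sumr i1) (bigD1 i)//= (innerZr i1) oe eqxx mulr1 big1 ?addr0//.
  by move=> j ji; rewrite (innerZr i1) oe eq_sym (negbTE ji) mulr0.
have PsiK : cancel Psi Phi by move=> w; apply/rowP => i; rewrite mxE g1Psi.
have [m [hm mE]] := volume_element_haar lPhi PhiK PsiK hmu.
pose lam i := g2 (e i) (e i).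
have lam0 i : 0 < lam i.
  apply: (inner_gt0 i2); apply/eqP => ei; have := oe i i.
  by rewrite ei (inner0l i1) eqxx => /eqP; rewrite eq_sym oner_eq0.
have g1dot w : g1 (Psi w) (Psi w) = dot w w.
  by rewrite {1}/Psi (inner_suml i1); apply: eq_bigr => i _; rewrite (innerZl i1) g1Psi.
have g2dot w : g2 (Psi w) (Psi w) = \sum_i lam i * w ord0 i ^+ 2.
  rewrite {1}/Psi (inner_suml i2); apply: eq_bigr => i _.
  by rewrite (innerZl i2) de g1Psi expr2 mulrCA.
pose Phi' (y : dualv V) : 'rV[R]_n := \row_i (y : 'Hom(V, R^o)) (e i).
have lf (w : 'rV[R]_n) : linear (fun x : V => dot w (Phi x) : R^o).
  by move=> a x y; rewrite lPhi dotDr dotZr.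
pose F (w : 'rV[R]_n) : {linear V -> R^o} :=
  HB.pack (fun x : V => dot w (Phi x) : R^o) (GRing.isLinear.Build _ _ _ _ _ (lf w)).
pose Psi' (w : 'rV[R]_n) : dualv V := linfun (F w).
have Psi'E w x : (Psi' w : 'Hom(V, R^o)) x = dot w (Phi x) by rewrite /Psi' lfunE.
have lPhi' : linear Phi'.
  by move=> a x y; apply/rowP => i; rewrite !mxE add_lfunE scale_lfunE.
have Phi'K : cancel Phi' Psi'.
  move=> y; apply/lfunP => x; rewrite Psi'E [in RHS](dec x) linear_sum.
  by apply: eq_bigr => i _; rewrite linearZ !mxE mulrC.
have Psi'K : cancel Psi' Phi'.
  move=> w; apply/rowP => i; rewrite mxE Psi'E /dot (bigD1 i)//= mxE oe eqxx mulr1 big1 ?addr0//.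
  by move=> j ji; rewrite mxE oe (negbTE ji) mulr0.
have [m' [hm' m'E]] := volume_element_haar lPhi' Phi'K Psi'K hnu.
(* In these coordinates [g2] is the sum of lam_i w_i^2, whose unit ball has semi-axes
   lam_i^(-1/2). *)
pose b : 'rV[R]_n := \row_i (Num.sqrt (lam i))^-1.
exists Psi, m, b, (fine (m' (box 1)) / fine (m (box 1))); split=> //.
- by rewrite divr_gt0// fine_haar_box_gt0.
- by move=> i; rewrite mxE invr_gt0 sqrtr_gt0.
- exact: linear_cancel lPhi PhiK PsiK.
split.
- by rewrite ell1; apply/seteqP; split=> w /=; rewrite g1dot.
- have bdot (w : 'rV[R]_n) :
      \sum_i lam i * w ord0 i ^+ 2 = dot (dil (invr_row b) w) (dil (invr_row b) w).
    apply: eq_bigr => i _; rewrite !mxE invrK mulrACA -!expr2 sqr_sqrtr//.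
    exact: ltW.
  by apply/seteqP; split=> w; rewrite /ell /ball1 /= g2dot bdot.
- exact: (compact_Psi lPhi PhiK PsiK).
- by move=> A; rewrite mE.
- move=> A bA; rewrite /vol -m'E.
  have -> : Psi' @^-1` polar A = pol (Psi @^-1` A).
    apply/seteqP; split=> w.
      move=> H u /= Au; have := H (dot w u); rewrite /= in_itv/= ler_norml dotC; apply.
      by exists (Psi u) => //; rewrite Psi'E PsiK dotC.
    move=> H _ [x Ax <-] /=; rewrite in_itv/= -ler_norml Psi'E dotC; apply: H.
    by rewrite /= PhiK.
  have bp := cbody_pol bA.
  rewrite (haar_prop hm hm')//; last exact: cbody_measurable.
  by rewrite fineM//; apply: haar_fin => //; case: bp.
Qed.

Theorem theorem1 (R : realType) (n : nat) (V : vectType R)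
    (mu : {measure set (borel V) -> \bar R})
    (nu : {measure set (borel (dualv V)) -> \bar R})
    (K E1 E2 : set V) (r : R) :
  \dim {:V} = n ->
  volume_element mu ->
  dual_volume_element mu nu ->
  convex_body K ->
  symmetric_set K ->
  ellipsoid E1 ->
  ellipsoid E2 ->
  2 <= r ->
  E1 `<=` K ->
  K `<=` E2 ->
  vol mu E2 / vol mu E1 = r ^+ n ->
  forall B : set V, ellipsoid B ->
    (vol mu K * vol nu (polar K)) / (vol mu B * vol nu (polar B))
      >= (2 * log2 r) ^- n.
Proof.
move=> <- {n} hmu [hnu _] [cK vK _] sK [g1 ->] [g2 ->] r2 EK KE volE B [gB ->].
have i1 := inner_dot g1; have i2 := inner_dot g2; have iB := inner_dot gB.
have o0 : pos_row (const_mx 1 : 'rV[R]_(\dim {:V})) by exact: pos_row_const.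
(* In coordinates adapted to the pair [g1], [gB], both products equal c (Vol ball1)^2; so [B] may be
   replaced by [E1]. *)
have -> : vol mu [set x | gB x x <= 1] * vol nu (polar [set x | gB x x <= 1]) =
    vol mu [set x | g1 x x <= 1] * vol nu (polar [set x | g1 x x <= 1]).
  have [Psi [m [b [c [hm c0 b0 lP [P1 PB _ muE nuE]]]]]] := ellipsoid_coordinates i1 iB hmu hnu.
  rewrite !nuE ?P1 ?PB; try exact: ell_cbody.
  rewrite /vol !muE P1 PB !(mulrCA _ c); congr (_ * _).
  by have := mahler_ell hm b0; have := mahler_ell hm o0; rewrite /mahler => -> ->.
have [Psi [m [b [c [hm c0 b0 lP [P1 P2 cP muE nuE]]]]]] := ellipsoid_coordinates i1 i2 hmu hnu.
pose K' := Psi @^-1` K.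
have EK' : ell (const_mx 1) `<=` K' by rewrite -P1 => w /EK.
have KE' : K' `<=` ell b by rewrite -P2 => w /KE.
have Psi0 : Psi 0 = 0 by have := lP (-1) 0 0; rewrite scaler0 addr0 scaleN1r addNr.
have PsiZ a x : Psi (a *: x) = a *: Psi x by have := lP a x 0; rewrite Psi0 !addr0.
have bK' : cbody K'.
  split.
  - exact: cP.
  - move=> x y t /andP[t0 t1] Kx Ky; rewrite /K' /= .
    have := vK (Psi x) (Psi y) (Itv01 t0 t1) (mem_set Kx) (mem_set Ky).
    rewrite inE; congr (K _).
    have lPD u w : Psi (u + w) = Psi u + Psi w by have := lP 1 u w; rewrite !scale1r.
    by rewrite lPD !PsiZ.
  - by move=> x Kx; rewrite /K' /= -scaleN1r PsiZ scaleN1r -sK; exists (Psi x).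
  - have [_ _ _ [d d0 dE]] := ell_cbody o0.
    by exists d => // x /dE/EK'.
have v1 := vol_gt0 hm (ell_cbody o0).
rewrite !nuE// ?P1; last exact: ell_cbody.
rewrite /vol !muE P1 -/K' in volE *.
have E2E : fine (m (ell b)) = r ^+ \dim {:V} * fine (m (ell (const_mx 1))).
  by rewrite -volE P2 divfK// gt_eqF.
(* Any [k] that is large enough will do; two applications of x < b^x bound [r] crudely. *)
have [k rk] : exists k, r <= 4 ^+ (2 ^ k)%N.
  exists (Num.truncn r).+1; apply: le_trans (ltW (truncnS_gt r)) _.
  rewrite -natrX ler_nat; apply: leq_trans (ltnW (ltn_expl _ (isT : 1 < 4)%N)).
  exact: ltnW (ltn_expl _ _).
have H := mahler_ge hm r2 rk o0 b0 bK' EK' KE' E2E.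
have Hm := mahler_ell hm o0.
rewrite !(mulrCA _ c) -mulf_div divff ?mul1r ?gt_eqF//.
rewrite -/(mahler m K') -/(mahler m (ell (const_mx 1))) Hm.
by rewrite ler_pdivlMr// exprn_gt0// vol_gt0//; exact: ball1_cbody.
Qed.
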